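(* Let $N\ge 20$ and let $\mathbf D=[d(i,j,k,\ell)]\in\mathbb R^{N\times N\times N\times N}$ be a fixed degenerate tensor. Let $\pi$ be uniformly distributed over $\mathcal S_N$ and $Q_d=\sum_{i,j\in[N]}d(i,j,\pi(i),\pi(j))$. Define $$B:=\max_{\sigma\in\mathcal S_N}\Big\|\big[d(i,j,\sigma(i),\sigma(j))\big]_{i,j}\Big\|_{\mathsf{op}},\qquad V:=\frac1N\sum_{i,k\in[N]}\xi(i,k)^2+\frac1{N^2}\sum_{\substack{i,j,k,\ell\in[N]\\ i\ne j,\ k\ne \ell}}d(i,j,k,\ell)^2,$$ where $$\xi(i,k):=d(i,i,k,k)-\frac1N\sum_{k'=1}^N d(i,i,k',k')-\frac1N\sum_{i'=1}^N d(i',i',k,k)+\frac1{N^2}\sum_{i',k'\in[N]}d(i',i',k',k').$$ Then, for all $\lambda\ge 0$ with $5400B\lambda<1$, $$\mathrm E\big[\exp(\lambda(Q_d-\mathrm E[Q_d]))\big]\le\exp\Big(\frac{100000\,V\lambda^2}{1-5400B\lambda}\Big),$$ and for any $t>0$, $$\mathrm P\big(Q_d-\mathrm E[Q_d]\ge t\big)\le\exp\Big(-\frac{t^2}{400000\,V+10800\,Bt}\Big).$$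
   Context: $[N]=\{1,\dots,N\}$ and $\mathcal S_N$ is the group of permutations of $[N]$. A tensor $\mathbf D=[d(i,j,k,\ell)]$ is degenerate if for all $i,j,k,\ell\in[N]$, $$\sum_{\ell'=1}^N d(i,j,k,\ell')=\sum_{k'=1}^N d(i,j,k',\ell)=\sum_{j'=1}^N d(i,j',k,\ell)=\sum_{i'=1}^N d(i',j,k,\ell)=0.$$ $[d(i,j,\sigma(i),\sigma(j))]_{i,j}$ is the $N\times N$ matrix whose $(i,j)$ entry is $d(i,j,\sigma(i),\sigma(j))$, and $\|\cdot\|_{\mathsf{op}}$ is the spectral (operator) norm. *)

(* Defs.v *)
From HB Require Import structures.
From mathcomp Require Import all_boot all_order all_algebra all_fingroup.
From mathcomp Require Import all_classical all_reals all_analysis.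
Import Order.TTheory GRing.Theory Num.Theory.
Import numFieldNormedType.Exports.

Set Implicit Arguments.
Unset Strict Implicit.
Unset Printing Implicit Defensive.

Local Open Scope classical_set_scope.
Local Open Scope ring_scope.

Section Tensors.
Variables (R : realType) (N : nat).

Definition tensor4 : Type := 'I_N -> 'I_N -> 'I_N -> 'I_N -> R.

Implicit Types (d : tensor4) (s : 'S_N).

Definition degenerate d : Prop := forall i j k l,
  [/\ \sum_(l' < N) d i j k l' = 0,
      \sum_(k' < N) d i j k' l = 0,
      \sum_(j' < N) d i j' k l = 0 &
      \sum_(i' < N) d i' j k l = 0].

Definition tensor_mx d s : 'M[R]_N := \matrix_(i, j) d i j (s i) (s j).

Definition quad_stat d s : R := \sum_(i < N) \sum_(j < N) d i j (s i) (s j).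

(* [`|x|] on matrices is the sup norm in the library, hence the explicit
   Euclidean norm. *)
Definition l2norm n (x : 'cV[R]_n) : R := Num.sqrt (\sum_(i < n) x i ord0 ^+ 2).

Definition op_norm m n (A : 'M[R]_(m, n)) : R :=
  sup [set l2norm (A *m x) | x in [set x : 'cV[R]_n | l2norm x <= 1]].

(* Operator norms are nonnegative and 'S_N is nonempty, so the default value 0
   does not affect the maximum. *)
Definition tensor_B d : R := \big[Num.max/0]_(s : 'S_N) op_norm (tensor_mx d s).

Definition tensor_xi d (i k : 'I_N) : R :=
  d i i k k
  - N%:R^-1 * \sum_(k' < N) d i i k' k'
  - N%:R^-1 * \sum_(i' < N) d i' i' k k
  + (N%:R ^+ 2)^-1 * \sum_(i' < N) \sum_(k' < N) d i' i' k' k'.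

Definition tensor_V d : R :=
  N%:R^-1 * (\sum_(i < N) \sum_(k < N) tensor_xi d i k ^+ 2)
  + (N%:R ^+ 2)^-1 *
    (\sum_(i < N) \sum_(j < N | i != j) \sum_(k < N) \sum_(l < N | k != l)
       d i j k l ^+ 2).

End Tensors.

Section Randomness.
Variables (R : realType) (dsp : measure_display) (Omega : measurableType dsp).
Variable P : probability Omega R.

(* Measurability of the fibres is measurability of [X] for the discrete
   sigma-algebra on [T]. *)
Definition uniformly_distributed (T : finType) (X : Omega -> T) : Prop :=
  forall a : T, measurable (X @^-1` [set a]) /\
                P (X @^-1` [set a]) = ((#|T|%:R)^-1)%:E.

(* To be used for integrable [X] only: [fine] sends infinite values to 0. *)
Definition centered (X : Omega -> R) (w : Omega) : R := X w - fine ('E_P[X])%E.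

End Randomness.

(* Main.v *)
(* Choose at random disjoint pairs of positions, split into two classes, and
   swap the images within each pair according to independent signs: this leaves
   the law of [pi] unchanged. Projecting onto the part that is odd in one sign
   of each class turns the statistic into a Rademacher bilinear form e^T C f,
   whose matrix satisfies |C| <= 2 B because it is a signed average of folded
   submatrices of [d(i,j,s(i),s(j))] over four permutations [s]. Degeneracy
   shows that averaging these forms over the choice of pairs gives back Q_d, up
   to a linear statistic in [xi] and a remainder with coefficient O(N^-2); by
   Jensen's inequality it thus suffices to bound each form. A Rademacher chaos
   bound yields E exp(mu e^T C f) <= exp(c mu^2 |C|_HS^2), and |C|_HS^2 is at
   most a sum of squares d(i,j,pi(i),pi(j))^2 over disjoint sets of i and j.
   The exponential moment of the latter is computed by resampling the images one
   position at a time among the free positions: the row and column norms, at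
   most B, keep the exponents small, and only the mean square V remains. *)
Require Import Defs.
From HB Require Import structures.
From mathcomp Require Import all_boot all_order all_algebra all_fingroup.
From mathcomp Require Import all_classical all_reals all_analysis.
From mathcomp Require Import measurable_realfun ring lra zify.
Import Order.TTheory GRing.Theory Num.Theory.
Import numFieldNormedType.Exports.

Set Implicit Arguments.
Unset Strict Implicit.
Unset Printing Implicit Defensive.

Local Open Scope ring_scope.

(** * Exponential inequalities *)

Section ExpInequalities.
Context {R : realType}.
Implicit Types x y : R.

(** Both sides agree at 0, and their difference has derivative [x (e^x - e^-x)], which is
    nonnegative for [x >= 0]. *)
Lemma tanh_le_id y : 0 <= y -> expR y - expR (- y) <= y * (expR y + expR (- y)).
Proof.
move=> y0; rewrite -subr_ge0.
pose f (x : R) := x * (expR x + expR (- x)) - (expR x - expR (- x)).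
have df x : is_derive x 1 f (x * (expR x - expR (- x))).
  rewrite /f; apply: is_derive_eq.
  by rewrite /GRing.scale /=; ring.
suff : f 0 <= f y by rewrite {1}/f mul0r oppr0 subrr subr0.
apply: (@ger0_derive1_ndecry R f 0) => //.
  move=> x; rewrite in_itv/= andbT => x0.
  rewrite derive1E (@derive_val _ _ _ _ _ _ _ (df x)).
  by rewrite mulr_ge0 ?ltW// subr_gt0 ltr_expR; lra.
apply: continuous_subspaceT => x.
by apply/differentiable_continuous/derivable1_diffP; case: (df x).
Qed.

(** The product of [exp (- x^2 / 2)] and [cosh x] equals 1 at 0 and decreases on the half-line: its
    derivative has the sign given by [tanh_le_id]. *)
Lemma cosh_le_expR y : (expR y + expR (- y)) / 2 <= expR (y ^+ 2 / 2).
Proof.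
wlog y0 : y / 0 <= y.
  move=> H; case: (lerP 0 y) => [/H//|/ltW y0].
  by have := H (- y); rewrite opprK addrC sqrrN; apply; rewrite oppr_ge0.
pose f (x : R) := expR (- (x ^+ 2 / 2)) * ((expR x + expR (- x)) / 2).
have df x : is_derive x 1 f (- expR (- (x ^+ 2 / 2)) *
   ((x * (expR x + expR (- x)) - (expR x - expR (- x))) / 2)).
  rewrite /f; apply: is_derive_eq.
  by rewrite /GRing.scale /=; field.
suff : f y <= f 0.
  rewrite /f expr0n/= mul0r oppr0 expR0 mul1r divff// expRN mulrC.
  by rewrite ler_pdivrMr ?expR_gt0// mul1r.
apply: (@ler0_derive1_nincry R f 0) => //.
  move=> x; rewrite in_itv/= andbT => x0.
  rewrite derive1E (@derive_val _ _ _ _ _ _ _ (df x)).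
  rewrite mulNr oppr_le0 mulr_ge0 ?expR_ge0// divr_ge0// subr_ge0.
  exact/tanh_le_id/ltW.
apply: continuous_subspaceT => x.
by apply/differentiable_continuous/derivable1_diffP; case: (df x).
Qed.

Lemma expR_le_sqr y : `|y| <= 3^-1 -> expR y <= 1 + y + y ^+ 2.
Proof.
rewrite ler_norml => /andP[y1 y2].
have h : expR (y / 2) <= (1 - y / 2)^-1.
  rewrite -[X in expR X]opprK expRN lef_pV2 ?posrE ?expR_gt0//; last lra.
  exact: expR_ge1Dx.
have -> : expR y = expR (y / 2) ^+ 2 by rewrite -expRM_natl; congr expR; field.
have p : 0 < 1 - y / 2 by lra.
apply: (@le_trans _ _ ((1 - y / 2)^-1 ^+ 2)).
  by apply: lerXn2r => //; rewrite nnegrE ?expR_ge0// invr_ge0 ltW.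
rewrite exprVn -[X in X <= _]mul1r ler_pdivrMr ?exprn_gt0//.
(* The factor [1 - 3 y + y^2] is nonnegative because [y <= 1/3]; this fixes the admissible range. *)
have -> : (1 + y + y ^+ 2) * (1 - y / 2) ^+ 2 =
  1 + y ^+ 2 * (1 - 3 * y + y ^+ 2) / 4 by field.
rewrite lerDl divr_ge0// mulr_ge0 ?sqr_ge0//.
by have := sqr_ge0 y; lra.
Qed.

(** The slope 6/5 is that of the chord of the convex function [1 / (1 - y)] from 0 to 1/6; hence the
    constants 1/6 and 6/5 in the peeling argument. *)
Lemma expR_le_lin y : 0 <= y -> y <= 6^-1 -> expR y <= 1 + 6 / 5 * y.
Proof.
move=> y0 y1.
have p : 0 < 1 - y by lra.
apply: (@le_trans _ _ (1 - y)^-1).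
  rewrite -[X in expR X]opprK expRN lef_pV2 ?posrE ?expR_gt0//.
  exact: expR_ge1Dx.
rewrite -[X in X <= _]mul1r ler_pdivrMr//; nra.
Qed.

Lemma expR_ge_tangent x y : expR x * (1 + (y - x)) <= expR y.
Proof.
by rewrite -{2}(subrKC x y) expRD ler_wpM2l ?expR_ge0 ?expR_ge1Dx.
Qed.

End ExpInequalities.

(** * Uniform means over finite types *)

Section Mean.
Context {R : realType}.

Lemma cauchy_schwarz_sum (T : finType) (a b : T -> R) :
  (\sum_t a t * b t) ^+ 2 <= (\sum_t a t ^+ 2) * (\sum_t b t ^+ 2).
Proof.
set S := \sum_t a t * b t; set A := \sum_t a t ^+ 2; set D := \sum_t b t ^+ 2.
have A0 : 0 <= A by apply: sumr_ge0 => t _; rewrite sqr_ge0.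
move: (A0); rewrite le_eqVlt => /predU1P[A00|Ap].
  have S0 : S = 0.
    apply: big1 => t _; suff /eqP : a t ^+ 2 == 0.
      by move/eqP; rewrite sqrf_eq0 => /eqP->; rewrite mul0r.
    by apply/eqP/(psumr_eq0P _ (esym A00)) => // i _; rewrite sqr_ge0.
  by rewrite S0 -A00 expr0n mul0r.
have : 0 <= \sum_t (A * b t - S * a t) ^+ 2 by apply: sumr_ge0 => t _; rewrite sqr_ge0.
have -> : \sum_t (A * b t - S * a t) ^+ 2 = A * (A * D - S ^+ 2).
  transitivity (\sum_t (A ^+ 2 * b t ^+ 2 - 2 * A * S * (a t * b t) + S ^+ 2 * a t ^+ 2)).
    by apply: eq_bigr => t _; ring.
  by rewrite big_split sumrB /= -!mulr_sumr -/S -/A -/D; ring.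
by rewrite pmulr_rge0 ?subr_ge0.
Qed.

Lemma sqr_sum_le (T : finType) (F : T -> R) :
  (\sum_t F t) ^+ 2 <= #|T|%:R * \sum_t F t ^+ 2.
Proof.
have := cauchy_schwarz_sum (fun=> 1) F.
under eq_bigr do rewrite mul1r.
by under [X in X * _]eq_bigr do rewrite expr1n; rewrite sumr_const.
Qed.

Definition mean (T : finType) (F : T -> R) : R := #|T|%:R^-1 * \sum_x F x.

Lemma eq_mean (T : finType) (F G : T -> R) : F =1 G -> mean F = mean G.
Proof. by move=> FG; rewrite /mean (eq_bigr _ (fun x _ => FG x)). Qed.

Lemma ler_mean (T : finType) (F G : T -> R) :
  (forall x, F x <= G x) -> mean F <= mean G.
Proof. by move=> FG; rewrite ler_wpM2l ?invr_ge0 ?ler0n// ler_sum. Qed.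

Lemma meanD (T : finType) (F G : T -> R) :
  mean (fun x => F x + G x) = mean F + mean G.
Proof. by rewrite /mean big_split mulrDr. Qed.

Lemma meanZ (T : finType) (c : R) (F : T -> R) :
  mean (fun x => c * F x) = c * mean F.
Proof. by rewrite /mean -big_distrr /= mulrCA. Qed.

Lemma meanN (T : finType) (F : T -> R) : mean (fun x => - F x) = - mean F.
Proof. by rewrite /mean sumrN mulrN. Qed.

Lemma mean_sum (T I : finType) (A : pred I) (F : I -> T -> R) :
  mean (fun x => \sum_(i | A i) F i x) = \sum_(i | A i) mean (F i).
Proof. by rewrite /mean exchange_big mulr_sumr. Qed.

Lemma exchange_mean (S T : finType) (F : S -> T -> R) :
  mean (fun x => mean (F x)) = mean (fun y => mean (F^~ y)).
Proof.
rewrite /mean -!mulr_sumr exchange_big !mulrA; congr (_ * _); exact: mulrC.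
Qed.

Lemma reindex_mean (T : finType) (h : T -> T) (F : T -> R) :
  injective h -> mean (F \o h) = mean F.
Proof. by move=> hI; rewrite /mean [in RHS](reindex_inj hI). Qed.

Lemma mean_cst (T : finType) (c : R) : (0 < #|T|)%N -> mean (fun _ : T => c) = c.
Proof.
by move=> T0; rewrite /mean sumr_const -[c *+ _]mulr_natl mulKf// pnatr_eq0 -lt0n.
Qed.

(** Jensen's inequality, from the tangent of the exponential at the mean. *)
Lemma expR_mean (T : finType) (F : T -> R) :
  (0 < #|T|)%N -> expR (mean F) <= mean (fun x => expR (F x)).
Proof.
move=> T0; set m := mean F.
have : mean (fun x => expR m * (1 + (F x - m))) <= mean (fun x => expR (F x)).
  by apply: ler_mean => x; apply: expR_ge_tangent.
by rewrite meanZ !meanD meanN !mean_cst// subrr addr0 mulr1.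
Qed.

Lemma card_perm_gt0 N : (0 < #|{: 'S_N}|)%N.
Proof. by apply/card_gt0P; exists 1%g. Qed.

(* Composing with the transposition of [x] and a free position [z] preserves the
   uniform distribution and moves [s x] to [s z]. *)
Lemma mean_swap N (Z : {set 'I_N}) (x : 'I_N) (H : 'S_N -> 'I_N -> R) :
  x \in Z ->
  (forall (s : 'S_N) z k, z \in Z -> H (tperm x z * s)%g k = H s k) ->
  mean (fun s : 'S_N => H s (s x)) =
  mean (fun s : 'S_N => #|Z|%:R^-1 * \sum_(z in Z) H s (s z)).
Proof.
move=> xZ HZ.
have Z0 : #|Z|%:R != 0 :> R by rewrite pnatr_eq0 -lt0n; apply/card_gt0P; exists x.
rewrite meanZ (mean_sum (fun z => z \in Z)).
rewrite (eq_bigr (fun=> mean (fun s : 'S_N => H s (s x)))).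
  by rewrite sumr_const -[mean _ *+ _]mulr_natl mulKf.
move=> z zZ; rewrite -(@reindex_mean _ (mulg (tperm x z)) (fun s => H s (s x))).
  by apply: eq_mean => s /=; rewrite HZ// permM tpermL.
exact: mulgI.
Qed.

End Mean.

(** * Joint laws of a few images of a uniform permutation *)

Section Coordinates.
Context {R : realType} {N : nat}.

(** Given the images of [A], the image of [x] is uniform over the remaining values: this is
    [mean_swap] with the complement of [A] as free positions. *)
Lemma mean_coord (A : seq 'I_N) (x : 'I_N) (F : seq 'I_N -> 'I_N -> R) :
  uniq (x :: A) ->
  mean (fun s : 'S_N => F (map s A) (s x)) =
  (N - size A)%:R^-1 *
  mean (fun s : 'S_N => \sum_(k | k \notin map s A) F (map s A) k).
Proof.
move=> /= /andP[xA uA].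
pose Z := [set z | z \notin A]%SET.
have cZ : #|Z| = (N - size A)%N.
  have := cardC (mem A); rewrite card_ord (card_uniqP uA) => e.
  by rewrite cardsE -(addKn (size A) #|_|) e.
rewrite (@mean_swap _ _ Z x (fun s k => F (map s A) k)); last 2 first.
- by rewrite inE.
- move=> s z k; rewrite inE => zA; congr (F _ k).
  apply/eq_in_map => i iA; rewrite permM tpermD//.
  + by apply: contraNneq xA => ->.
  + by apply: contraNneq zA => ->.
rewrite cZ meanZ; congr (_ * _); apply: eq_mean => s.
rewrite [RHS](reindex_inj (@perm_inj _ s)); apply: eq_bigl => z.
by rewrite inE mem_map//; exact: perm_inj.
Qed.

Lemma mean1 (x : 'I_N) (F : 'I_N -> R) :
  mean (fun s : 'S_N => F (s x)) = N%:R^-1 * \sum_k F k.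
Proof.
rewrite (@mean_coord [::] x (fun _ k => F k))//= subn0; congr (_ * _).
exact/mean_cst/card_perm_gt0.
Qed.

Lemma mean2 (x y : 'I_N) (F : 'I_N -> 'I_N -> R) : x != y ->
  mean (fun s : 'S_N => F (s x) (s y)) =
  (N * N.-1)%:R^-1 * \sum_i \sum_(j | j != i) F i j.
Proof.
move=> xy.
rewrite (@mean_coord [:: x] y (fun l k => F (head k l) k)) /=; last first.
  by rewrite inE eq_sym xy.
under eq_mean do under eq_bigl do rewrite inE.
rewrite (mean1 x (fun i => \sum_(j | j != i) F i j)) natrM invfM mulrCA !mulrA subn1.
by rewrite [_^-1 * _]mulrC.
Qed.

Lemma mean4 (x y z w : 'I_N) (F : 'I_N -> 'I_N -> 'I_N -> 'I_N -> R) :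
  uniq [:: w; z; y; x] ->
  mean (fun s : 'S_N => F (s x) (s y) (s z) (s w)) =
  (N * (N - 1) * (N - 2) * (N - 3))%:R^-1 *
  \sum_i \sum_(j | j \notin [:: i]) \sum_(k | k \notin [:: i; j])
     \sum_(l | l \notin [:: i; j; k]) F i j k l.
Proof.
move=> u.
move: u; rewrite /= !inE !negb_or !andbT.
move=> /and3P[/and3P[wz wy wx] /andP[zy zx] yx].
have u3 : uniq [:: w; x; y; z].
  by rewrite /= !inE !negb_or wz wy wx [x == z]eq_sym zx [x == y]eq_sym yx [y == z]eq_sym zy.
have u2 : uniq [:: z; x; y] by rewrite /= !inE !negb_or zy zx [x == y]eq_sym yx.
have u1 : uniq [:: y; x] by rewrite /= !inE yx.
rewrite (@mean_coord [:: x; y; z] w (fun m l =>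
   if m is [:: i; j; k] then F i j k l else 0))//=.
rewrite (@mean_coord [:: x; y] z (fun m k => if m is [:: i; j] then
   \sum_(l | l \notin [:: i; j; k]) F i j k l else 0))//=.
rewrite (@mean_coord [:: x] y (fun m j => if m is [:: i] then
   \sum_(k | k \notin [:: i; j])
     \sum_(l | l \notin [:: i; j; k]) F i j k l else 0))//=.
rewrite (mean1 x (fun i => \sum_(j | j \notin [:: i]) \sum_(k | k \notin [:: i; j])
     \sum_(l | l \notin [:: i; j; k]) F i j k l)) !mulrA !natrM !invfM.
by congr (_ * _); ring.
Qed.

End Coordinates.

(** * Nonnegative permutation statistics *)

Section Peeling.
Context {R : realType} {N : nat}.
Variables (J : {set 'I_N}) (y : 'I_N -> 'S_N -> 'I_N -> R).
Hypothesis y_inv : forall i x z s k,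
  x \notin J -> z \notin J -> y i (tperm x z * s)%g k = y i s k.
Hypothesis y_ge0 : forall i s k, 0 <= y i s k.

(** Conditionally on what [G] and [y x] see, [s x] is uniform over the images of the free positions.
    The exponential is linearised by [expR_le_lin], averaged, and restored by [1 + u <= exp u]; the
    factor 6/5 over the number of free positions is at most [r]. *)
Lemma peel_one (B : {set 'I_N}) (x : 'I_N) (G : 'S_N -> R) (r : R) :
  x \notin B -> x \notin J ->
  (forall s, 0 <= G s) ->
  (forall z s, z \notin B -> z \notin J -> G (tperm x z * s)%g = G s) ->
  (forall s z, z \notin J -> y x s (s z) <= 6^-1) ->
  6 / 5 <= r * #|~: (B :|: J)|%:R ->
  mean (fun s : 'S_N => G s * expR (y x s (s x))) <=
  mean (fun s : 'S_N => G s * expR (r * \sum_k y x s k)).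
Proof.
move=> xB xJ G0 Ginv small hr; set Z := (~: (B :|: J))%SET in hr *.
have inZ z : z \in Z = (z \notin B) && (z \notin J) by rewrite !inE negb_or.
have xZ : x \in Z by rewrite inZ xB xJ.
have Zn : 0 < #|Z|%:R :> R by rewrite ltr0n; apply/card_gt0P; exists x.
rewrite (@mean_swap _ _ Z x (fun s k => G s * expR (y x s k)))//; last first.
  by move=> s z k; rewrite inZ => /andP[zB zJ]; rewrite Ginv// y_inv.
apply: ler_mean => s; rewrite -mulr_sumr mulrCA ler_wpM2l//.
apply: le_trans (expR_ge1Dx _).
apply: (@le_trans _ _ (#|Z|%:R^-1 * \sum_(z in Z) (1 + 6 / 5 * y x s (s z)))).
  rewrite ler_wpM2l ?invr_ge0 ?ler0n// ler_sum// => z.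
  by rewrite inZ => /andP[_ zJ]; apply: expR_le_lin; rewrite ?small.
rewrite big_split /= sumr_const -[1 *+ _]mulr_natl mulr1 mulrDr mulVf ?gt_eqF//.
rewrite lerD2l -mulr_sumr mulrA.
have S0 : 0 <= \sum_(z in Z) y x s (s z) by apply: sumr_ge0.
have S1 : \sum_(z in Z) y x s (s z) <= \sum_k y x s k.
  rewrite [leRHS](reindex_inj (@perm_inj _ s)) [leRHS](bigID (mem Z))/= lerDl.
  exact: sumr_ge0.
have rZ : #|Z|%:R^-1 * (6 / 5) <= r.
  by rewrite mulrC ler_pdivrMr.
exact: ler_pM.
Qed.

(* The exponent is removed one position at a time. When [J] is nonempty, the
   images of its positions are kept fixed and [y] may depend on them. *)
Lemma peel (A : {set 'I_N}) (r : R) :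
  [disjoint A & J] ->
  (forall i s z, i \in A -> z \notin J -> y i s (s z) <= 6^-1) ->
  6 / 5 <= r * (N - #|A| - #|J|)%:R ->
  mean (fun s : 'S_N => expR (\sum_(i in A) y i s (s i))) <=
  mean (fun s : 'S_N => expR (r * \sum_(i in A) \sum_k y i s k)).
Proof.
move=> AJ small hr.
have r0 : 0 <= r.
  rewrite leNgt; apply/negP => r0.
  have : r * (N - #|A| - #|J|)%:R <= 0 by rewrite mulr_le0_ge0// ltW.
  by lra.
(* [B] holds the positions whose factor is still random; each other position of [A] has been
   replaced by its sum over all values. *)
suff H m (B : {set 'I_N}) : #|B| = m -> B \subset A ->
    mean (fun s : 'S_N => expR (\sum_(i in B) y i s (s i) +
                                r * \sum_(i in A :\: B) \sum_k y i s k)) <=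
    mean (fun s : 'S_N => expR (r * \sum_(i in A) \sum_k y i s k)).
  apply: le_trans (H _ A erefl (fintype.subxx _)).
  by apply: ler_mean => s; rewrite finset.setDv big_set0 mulr0 addr0.
elim: m B => [B /eqP|m IH B Bm BA].
  rewrite cards_eq0 => /eqP-> _.
  by apply: ler_mean => s; rewrite big_set0 add0r finset.setD0.
have /card_gt0P[x xB] : (0 < #|B|)%N by rewrite Bm.
have xA : x \in A by apply: (fintype.subsetP BA).
have xJ : x \notin J by rewrite (disjointFr AJ xA).
have Bm' : #|B :\ x| = m by move: Bm; rewrite (cardsD1 x B) xB => -[].
apply: le_trans (IH (B :\ x) Bm' (fintype.subset_trans (finset.subsetDl _ _) BA)).
pose G s := expR (\sum_(i in B :\ x) y i s (s i) +
                   r * \sum_(i in A :\: B) \sum_k y i s k).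
have -> : mean (fun s : 'S_N => expR (\sum_(i in B) y i s (s i) +
      r * \sum_(i in A :\: B) \sum_k y i s k)) =
    mean (fun s : 'S_N => G s * expR (y x s (s x))).
  apply: eq_mean => s; rewrite -expRD; congr expR.
  by rewrite (big_setD1 x)//=; ring.
apply: le_trans (@peel_one (B :\ x) x G r _ _ _ _ _ _) _ => //.
- by rewrite !inE eqxx.
- by move=> s; apply: expR_ge0.
- move=> z s zB zJ; congr expR; congr (_ + _ * _).
    apply: eq_bigr => i iB; rewrite y_inv// permM tpermD//.
      by apply: contraTneq iB => <-; rewrite !inE eqxx.
    by apply: contraNneq zB => ->.
  by apply: eq_bigr => i _; apply: eq_bigr => k _; rewrite y_inv.
- by move=> s z zJ; apply: small.
- apply: le_trans hr _; rewrite ler_wpM2l// ler_nat.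
  have := cardsC ((B :\ x) :|: J); rewrite card_ord.
  have [+ _] := leq_card_setU (B :\ x) J.
  have := subset_leq_card BA; lia.
apply: ler_mean => s; rewrite /G -expRD ler_expR.
have -> : A :\: (B :\ x) = x |: (A :\: B).
  by apply/setP => i; rewrite !inE; case: eqVneq => //= ->; rewrite xA.
rewrite big_setU1 ?inE ?xB//= mulrDr.
by rewrite -addrA [X in _ + X <= _]addrC.
Qed.

End Peeling.

(** * Rademacher chaos *)

Section RademacherChaos.
Context {R : realType}.
Implicit Types (Z : finType).

Lemma sqr_sign (b : bool) : ((-1) ^+ b : R) ^+ 2 = 1.
Proof. by rewrite sqrr_sign. Qed.

(** By independence of the signs the mean is a product of factors [cosh (y z)]. *)
Lemma rad_linear Z (y : Z -> R) :
  mean (fun e : {ffun Z -> bool} => expR (\sum_z (-1) ^+ e z * y z)) <=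
  expR ((\sum_z y z ^+ 2) / 2).
Proof.
rewrite /mean card_ffun card_bool.
under eq_bigr do rewrite expR_sum.
rewrite -(bigA_distr_bigA (fun z (b : bool) => expR ((-1) ^+ b * y z))).
rewrite mulr_suml expR_sum natrX -exprVn -prodr_const -big_split /=.
apply: ler_prod => z _; rewrite big_bool /= expr0 expr1 mul1r mulN1r.
rewrite mulrC addrC cosh_le_expR andbT.
by rewrite divr_ge0// addr_ge0// expR_ge0.
Qed.

Section Quadratic.
Variables (Z : finType) (kap : R).
Hypotheses (kap0 : 0 < kap) (kap1 : kap < 2^-1).

Let quad (S : {set Z}) (K : Z -> Z -> R) (u : Z -> R) :=
  \sum_(p in S) \sum_(q in S) u p * u q * K p q.

Let quad_split (S : {set Z}) K x (u : Z -> R) c : x \in S ->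
  (forall p q, K p q = K q p) ->
  quad S K (fun p => if p == x then c else u p) =
  c ^+ 2 * K x x + 2 * c * (\sum_(q in S :\ x) u q * K x q) + quad (S :\ x) K u.
Proof.
move=> xS Ks; rewrite /quad (big_setD1 x)//= (big_setD1 x)//= eqxx.
have E p : p \in S :\ x -> p == x = false by rewrite !inE => /andP[/negbTE->].
under eq_bigr => q qS do rewrite (E _ qS) -mulrA.
under [X in _ + X = _]eq_bigr => p pS.
  rewrite (E _ pS) (big_setD1 x)//= eqxx [u p * c]mulrC -mulrA [K p x]Ks.
  under eq_bigr => q qS do rewrite (E _ qS).
  over.
by rewrite big_split /= -!mulr_sumr; ring.
Qed.

Let sum_split (S : {set Z}) x (u : Z -> R) c : x \in S ->
  \sum_(p in S) (if p == x then c else u p) ^+ 2 =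
  c ^+ 2 + \sum_(p in S :\ x) u p ^+ 2.
Proof.
move=> xS; rewrite (big_setD1 x)//= eqxx; congr (_ + _).
by apply: eq_bigr => p; rewrite !inE => /andP[/negbTE->].
Qed.

(* Averaging out the sign of [x] replaces [K] by [K + 2 K_x K_x^T] on the
   remaining coordinates. Testing [K] on the vector [(2 (K_x | u), u)] shows
   that the upper bound [kap] is inherited. *)
Lemma rad_quadratic (S : {set Z}) (K : Z -> Z -> R) :
  (forall p q, K p q = K q p) ->
  (forall u, 0 <= \sum_(p in S) \sum_(q in S) u p * u q * K p q) ->
  (forall u, \sum_(p in S) \sum_(q in S) u p * u q * K p q <=
             kap * \sum_(p in S) u p ^+ 2) ->
  mean (fun e : {ffun Z -> bool} =>
    expR (\sum_(p in S) \sum_(q in S) (-1) ^+ e p * (-1) ^+ e q * K p q)) <=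
  expR ((\sum_(p in S) K p p) / (1 - 2 * kap)).
Proof.
move: {2}#|S| (erefl #|S|) => m; elim: m S K => [S K /eqP S0|m IH S K Sm] Ks K0 K1.
  move: S0; rewrite cards_eq0 => /eqP->; rewrite big_set0 mul0r expR0.
  under eq_mean do rewrite big_set0 expR0.
  by rewrite mean_cst//; apply/card_gt0P; exists [ffun=> true].
have /card_gt0P[x xS] : (0 < #|S|)%N by rewrite Sm.
have S'm : #|S :\ x| = m by move: Sm; rewrite (cardsD1 x S) xS => -[].
set S' := S :\ x in S'm.
have Kxx : 0 <= K x x.
  have := K0 (fun p => if p == x then 1 else 0).
  rewrite -/(quad _ _ _) quad_split// expr1n mul1r big1 => [|q _]; last exact: mul0r.
  by rewrite mulr0 addr0 /quad big1 ?addr0// => p _; rewrite big1// => q _; ring.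
pose k2 := \sum_(q in S') K x q ^+ 2.
(* A consequence of [K^2 <= kap K] at the entry [x], obtained by testing the upper bound on
   [(0, K_x)] and positivity on [(1, - K_x / kap)]. *)
have k2le : k2 <= kap * K x x.
  have h1 := K1 (fun p => if p == x then 0 else K x p).
  rewrite -/(quad _ _ _) quad_split// sum_split// in h1.
  have h0 := K0 (fun p => if p == x then 1 else - kap^-1 * K x p).
  rewrite -/(quad _ _ _) quad_split// -/S' in h0.
  have e1 : \sum_(q in S') - kap^-1 * K x q * K x q = - kap^-1 * k2.
    by rewrite mulr_sumr; apply: eq_bigr => q _; ring.
  have e2 : quad S' K (fun p => - kap^-1 * K x p) = kap^-1 ^+ 2 * quad S' K (K x).
    rewrite /quad mulr_sumr; apply: eq_bigr => p _; rewrite mulr_sumr.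
    by apply: eq_bigr => q _; ring.
  rewrite e1 e2 in h0; rewrite -/S' -/k2 in h1.
  have h2 : kap^-1 ^+ 2 * quad S' K (K x) <= kap^-1 * k2.
    rewrite expr2 -mulrA ler_wpM2l//; first by rewrite invr_ge0 ltW.
    by rewrite ler_pdivrMl//; lra.
  have h3 : kap^-1 * k2 <= K x x by lra.
  by rewrite -ler_pdivrMl.
pose K' p q := K p q + 2 * (K x p * K x q).
have quadK' u : quad S' K' u = quad S' K u + 2 * (\sum_(q in S') u q * K x q) ^+ 2.
  rewrite expr2 mulr_suml mulr_sumr -big_split; apply: eq_bigr => p _ /=.
  rewrite mulr_sumr mulr_sumr -big_split; apply: eq_bigr => q _ /=.
  by rewrite /K'; ring.
have qK'0 v : 0 <= quad S' K' v.
  rewrite quadK'; apply: addr_ge0; last by rewrite mulr_ge0 ?sqr_ge0.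
  have := K0 (fun p => if p == x then 0 else v p).
  by rewrite -/(quad _ _ _) quad_split// expr0n/= !mul0r mulr0 mul0r !add0r.
have K'1 u : quad S' K' u <= kap * \sum_(p in S') u p ^+ 2.
  rewrite quadK'; set X := \sum_(q in S') _.
  have := K1 (fun p => if p == x then 2 * X else u p).
  rewrite -/(quad _ _ _) quad_split// sum_split// -/S' -/X.
  have : 0 <= X ^+ 2 * K x x by rewrite mulr_ge0 ?sqr_ge0.
  have : 0 <= X ^+ 2 * (2^-1 - kap) by rewrite mulr_ge0 ?sqr_ge0// subr_ge0 ltW.
  by nra.
have IH' := IH S' K' S'm _ qK'0 K'1.
pose L (e : {ffun Z -> bool}) := \sum_(q in S') (-1) ^+ e q * K x q.
pose Q (e : {ffun Z -> bool}) := quad S' K (fun p => (-1) ^+ e p).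
have expE (e : {ffun Z -> bool}) :
    \sum_(p in S) \sum_(q in S) (-1) ^+ e p * (-1) ^+ e q * K p q =
    K x x + Q e + 2 * ((-1) ^+ e x * L e).
  have := @quad_split S K x (fun p => (-1) ^+ e p) ((-1) ^+ e x) xS Ks.
  rewrite sqr_sign mul1r -/S' -/(L e) -/(Q e) => h.
  transitivity (K x x + 2 * (-1) ^+ e x * L e + Q e); last by ring.
  rewrite -h /quad; apply: eq_bigr => p _; apply: eq_bigr => q _.
  by do 2 (case: eqP => [->|_] //).
pose flip (e : {ffun Z -> bool}) := [ffun z => if z == x then ~~ e z else e z].
have flipK : involutive flip.
  by move=> e; apply/ffunP => z; rewrite !ffunE; case: eqP; rewrite ?negbK.
have flip' e p : p \in S' -> flip e p = e p.
  by rewrite !inE ffunE => /andP[/negbTE->].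
have Lflip e : L (flip e) = L e.
  by apply: eq_bigr => q qS; rewrite flip'.
have Qflip e : Q (flip e) = Q e.
  by apply: eq_bigr => p pS; apply: eq_bigr => q qS; rewrite !flip'.
set F := fun e : {ffun Z -> bool} => _.
(* Pairing [e] with [flip e] averages out the sign of [x] and leaves [cosh (2 L e)], at most
   [exp (2 L e ^ 2)]; this square is the rank-one term of [K']. *)
have -> : mean F = mean (fun e => (F e + F (flip e)) / 2).
  under [RHS]eq_mean do rewrite mulrC.
  rewrite meanZ meanD -[mean (fun x => F (flip x))]/(mean (F \o flip)).
  by rewrite (reindex_mean F (inv_inj flipK)); field.
apply: (@le_trans _ _ (mean (fun e : {ffun Z -> bool} => expR (K x x) * 
    expR (\sum_(p in S') \sum_(q in S') (-1) ^+ e p * (-1) ^+ e q * K' p q)))).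
  apply: ler_mean => e; rewrite /F !expE Lflip Qflip.
  rewrite -/(quad S' K' (fun p => (-1) ^+ e p)) quadK' -/(L e) -/(Q e).
  have -> : (-1) ^+ flip e x = - (-1) ^+ e x :> R.
    by rewrite ffunE eqxx; case: (e x) => /=; rewrite !expr1 ?expr0 ?opprK.
  have := cosh_le_expR (2 * ((-1) ^+ e x * L e)).
  have -> : (2 * ((-1) ^+ e x * L e)) ^+ 2 / 2 = 2 * L e ^+ 2.
    by rewrite !exprMn sqr_sign; field.
  move=> /(ler_wpM2l (expR_ge0 (K x x + Q e))).
  rewrite mulNr mulrN !expRD -!mulrA.
  by apply: le_trans; rewrite le_eqVlt; apply/orP; left; apply/eqP; field.
rewrite meanZ; apply: (@le_trans _ _ (expR (K x x) *
   expR ((\sum_(p in S') K' p p) / (1 - 2 * kap)))).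
  rewrite ler_wpM2l ?expR_ge0//; apply: IH' => p q.
  by rewrite /K' Ks; ring.
(* The trace has grown by [2 k2 <= 2 kap K x x], which is exactly what dividing [K x x] by
   [1 - 2 kap] pays for. *)
rewrite -expRD ler_expR [leRHS](_ : _ = (K x x + \sum_(p in S') K p p) / (1 - 2 * kap)).
  have -> : \sum_(p in S') K' p p = \sum_(p in S') K p p + 2 * k2.
    by rewrite mulr_sumr -big_split; apply: eq_bigr => p _; rewrite /K' expr2.
  have d0 : 0 < 1 - 2 * kap by move: kap1; lra.
  rewrite ler_pdivlMr// mulrDl divfK ?gt_eqF//.
  lra.
by rewrite (big_setD1 x).
Qed.

End Quadratic.

(** Averaging over [e0] by [rad_linear] leaves a chaos in [e1] with Gram matrix [mu^2 / 2 C^T C].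
    Its largest eigenvalue is at most [mu^2 b / 2], and its trace is [mu^2 / 2] times the squared
    Hilbert-Schmidt norm of [C], so [rad_quadratic] applies. *)
Lemma rad_bilinear (Z1 Z2 : finType) (C : Z1 -> Z2 -> R) (mu b kap : R) :
  0 < kap -> kap < 2^-1 -> mu ^+ 2 / 2 * b <= kap ->
  (forall v, \sum_p (\sum_q C p q * v q) ^+ 2 <= b * \sum_q v q ^+ 2) ->
  mean (fun e0 : {ffun Z1 -> bool} => mean (fun e1 : {ffun Z2 -> bool} =>
    expR (mu * \sum_p \sum_q (-1) ^+ e0 p * (-1) ^+ e1 q * C p q))) <=
  expR (mu ^+ 2 / 2 * (\sum_p \sum_q C p q ^+ 2) / (1 - 2 * kap)).
Proof.
move=> kap0 kap1 hb hC; rewrite exchange_mean.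
pose K q q' := mu ^+ 2 / 2 * \sum_p C p q * C p q'.
have quadE (v : Z2 -> R) :
    \sum_(q in [set: Z2]%SET) \sum_(q' in [set: Z2]%SET) v q * v q' * K q q' =
    mu ^+ 2 / 2 * \sum_p (\sum_q C p q * v q) ^+ 2.
  under eq_bigl do rewrite inE.
  transitivity (\sum_q \sum_q' \sum_p mu ^+ 2 / 2 * (C p q * v q * (C p q' * v q'))).
    apply: eq_bigr => q _; rewrite (eq_bigl xpredT) => [|q']; last by rewrite inE.
    apply: eq_bigr => q' _; rewrite /K mulrCA mulr_sumr mulr_sumr.
    by apply: eq_bigr => p _; ring.
  under eq_bigr do rewrite exchange_big.
  rewrite exchange_big mulr_sumr; apply: eq_bigr => p _ /=.
  rewrite [X in _ = _ * X]expr2 mulr_suml mulr_sumr; apply: eq_bigr => q _.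
  by rewrite mulr_sumr mulr_sumr.
have h := @rad_quadratic Z2 kap kap0 kap1 [set: Z2] K.
apply: (@le_trans _ _ (mean (fun e1 : {ffun Z2 -> bool} =>
    expR (\sum_(p in [set: Z2]%SET) \sum_(q in [set: Z2]%SET)
      (-1) ^+ e1 p * (-1) ^+ e1 q * K p q)))).
  apply: ler_mean => e1.
  pose y p := mu * \sum_q C p q * (-1) ^+ e1 q.
  have e2 : \sum_p y p ^+ 2 / 2 = mu ^+ 2 / 2 * \sum_p (\sum_q C p q * (-1) ^+ e1 q) ^+ 2.
    by rewrite mulr_sumr; apply: eq_bigr => p _; rewrite /y exprMn; ring.
  rewrite quadE -e2 -mulr_suml.
  apply: le_trans (rad_linear y); rewrite le_eqVlt; apply/orP; left; apply/eqP.
  apply: eq_mean => e0; congr expR; rewrite mulr_sumr; apply: eq_bigr => p _.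
  rewrite /y !mulr_sumr; apply: eq_bigr => q _; ring.
apply: le_trans (h _ _ _) _.
- by move=> p q; rewrite /K; congr (_ * _); apply: eq_bigr => r _; rewrite mulrC.
- by move=> u; rewrite quadE mulr_ge0 ?divr_ge0 ?sqr_ge0// sumr_ge0// => p _; rewrite sqr_ge0.
- move=> u; rewrite quadE [X in _ <= _ * X](eq_bigl xpredT) => [|q]; last by rewrite inE.
  apply: (@le_trans _ _ (mu ^+ 2 / 2 * (b * \sum_q u q ^+ 2))).
    by rewrite ler_wpM2l// divr_ge0// sqr_ge0.
  by rewrite mulrA ler_wpM2r// sumr_ge0// => q _; rewrite sqr_ge0.
rewrite (eq_bigl xpredT) => [|q]; last by rewrite inE.
rewrite /K -mulr_sumr exchange_big.
by under eq_bigr do under eq_bigr do rewrite -expr2.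
Qed.

End RademacherChaos.

(** * Random sign flips of a permutation *)

Section Flips.
Context {R : realType} {N : nat} {Z : finType}.
Variable pos : Z * bool -> 'I_N.
Hypothesis pos_inj : injective pos.

(** The [pick] inverts [pos] on its range; all other positions stay fixed. *)
Let flip_pos (e : Z -> bool) (i : 'I_N) : 'I_N :=
  if [pick z | pos z == i] is Some z then pos (z.1, z.2 (+) e z.1) else i.

Let flip_posE e z b : flip_pos e (pos (z, b)) = pos (z, b (+) e z).
Proof.
rewrite /flip_pos; case: pickP => [w /eqP/pos_inj->//|/(_ (z, b))].
by rewrite eqxx.
Qed.

Let flip_posK e : involutive (flip_pos e).
Proof.
move=> i; rewrite {2}/flip_pos; case: pickP => [[z b] /eqP <-|H].
  by rewrite flip_posE /= addbK.
by rewrite /flip_pos; case: pickP => // w; rewrite H.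
Qed.

Definition flip_perm e : 'S_N := perm (inv_inj (flip_posK e)).

Lemma flip_permE e z b : flip_perm e (pos (z, b)) = pos (z, b (+) e z).
Proof. by rewrite permE flip_posE. Qed.

Lemma mean_flip (F : 'S_N -> R) :
  mean F = mean (fun s : 'S_N => mean (fun e : {ffun Z -> bool} => F (flip_perm e * s)%g)).
Proof.
rewrite exchange_mean -[LHS](@mean_cst _ {ffun Z -> bool}).
  by apply: eq_mean => e; rewrite -[LHS](reindex_mean F (@mulgI _ (flip_perm e))).
by apply/card_gt0P; exists [ffun=> true].
Qed.

Section Linear.
Variable g : 'I_N -> 'I_N -> R.

(** The part of the contribution of pair [z] that is odd under the swap of its two images. *)
Definition lin_diff (s : 'S_N) (z : Z) : R :=
  (g (pos (z, true)) (s (pos (z, true))) + g (pos (z, false)) (s (pos (z, false)))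
   - g (pos (z, true)) (s (pos (z, false))) - g (pos (z, false)) (s (pos (z, true)))) / 2.

Lemma lin_diff_flip e s z :
  lin_diff (flip_perm e * s)%g z = (-1) ^+ e z * lin_diff s z.
Proof.
rewrite /lin_diff !permM !flip_permE /=.
by case: (e z) => /=; rewrite ?expr0 ?expr1; ring.
Qed.

(** After [rad_linear], the square of [lin_diff] is at most the sum of the squares of its four
    entries: two belong to [s], two to [s] with all pairs swapped. Jensen separates the two halves,
    and invariance of the law identifies their means. *)
Lemma mgf_lin_diff (mu : R) :
  mean (fun s : 'S_N => expR (mu * \sum_z lin_diff s z)) <=
  mean (fun s : 'S_N => expR (mu ^+ 2 * \sum_z \sum_b g (pos (z, b)) (s (pos (z, b))) ^+ 2)).
Proof.
rewrite mean_flip.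
pose on (s : 'S_N) z := \sum_b g (pos (z, b)) (s (pos (z, b))) ^+ 2.
pose E s := expR (mu ^+ 2 * \sum_z on s z).
pose t := flip_perm (fun=> true).
apply: (@le_trans _ _ (mean (fun s : 'S_N => 2^-1 * (E s + E (t * s)%g)))).
  apply: ler_mean => s.
  under eq_mean do under eq_bigr do rewrite lin_diff_flip.
  under eq_mean => e do rewrite mulr_sumr.
  under eq_mean => e do under eq_bigr do rewrite mulrCA.
  apply: le_trans (rad_linear _) _.
  apply: (@le_trans _ _ (expR (2^-1 * (mu ^+ 2 * \sum_z on s z) +
                               2^-1 * (mu ^+ 2 * \sum_z on (t * s)%g z)))).
    rewrite ler_expR -!mulrDr -big_split mulrC ler_wpM2l// mulr_sumr ler_sum// => z _.
    rewrite exprMn ler_wpM2l ?sqr_ge0//.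
    rewrite /lin_diff /on !big_bool /= !permM !flip_permE /=.
    set a := g _ _; set b := g _ _; set c := g _ _; set d := g _ _.
    rewrite -subr_ge0 [X in 0 <= X](_ : _ =
      ((a - b) ^+ 2 + (c - d) ^+ 2 + (a + b + c + d) ^+ 2) / 4 +
        ((a - b) ^+ 2 + (c - d) ^+ 2) / 4); last by field.
    by rewrite addr_ge0// divr_ge0// ?addr_ge0 ?sqr_ge0.
  rewrite -[X in _ <= X]addr0.
  set x := _ * \sum_z _; set y := _ * \sum_z _.
  rewrite /E -/x -/y addr0.
  have := @expR_mean _ bool (fun b => if b then x else y) _.
  rewrite /mean card_bool !big_bool !mulrDr; exact.
rewrite meanZ meanD -[mean (fun x => E (t * x)%g)]/(mean (E \o mulg t)).
by rewrite (reindex_mean E (@mulgI _ t)); lra.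
Qed.

End Linear.
End Flips.

(** * Sign flips on two classes of pairs *)

Section BilinearFlips.
Context {R : realType} {N : nat} {P : finType}.
Variable pos : (bool * P) * bool -> 'I_N.
Hypothesis pos_inj : injective pos.
Variables (d : tensor4 R N) (B : R).
Hypothesis dB : forall (s : 'S_N) (u v : 'I_N -> R),
  (\sum_i \sum_j u i * v j * d i j (s i) (s j)) ^+ 2 <=
  B ^+ 2 * ((\sum_i u i ^+ 2) * (\sum_j v j ^+ 2)).

(* The coefficient of the signs of the pairs [p] and [q] in the statistic, as a
   function of the swaps within the pairs. *)
Definition bil_diff (s : 'S_N) (p q : P) : R :=
  (\sum_b \sum_b' \sum_c \sum_c' (-1) ^+ (b (+) b' (+) (c (+) c')) *
     d (pos (false, p, b)) (pos (true, q, c))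
       (s (pos (false, p, b'))) (s (pos (true, q, c')))) / 4.

Definition bil_on (s : 'S_N) (p q : P) : R :=
  \sum_b \sum_c d (pos (false, p, b)) (pos (true, q, c))
                  (s (pos (false, p, b))) (s (pos (true, q, c))).

(** Swaps whole classes of pairs at once, so that only four permutations occur; [pflip] below has
    one sign per pair. *)
Let cflip (e0 e1 : bool) : 'S_N := flip_perm pos_inj (fun z => if z.1 then e1 else e0).

Let pflip (e0 e1 : P -> bool) : 'S_N :=
  flip_perm pos_inj (fun z => if z.1 then e1 z.2 else e0 z.2).

Lemma bil_diff_flip e0 e1 s p q :
  bil_diff (pflip e0 e1 * s)%g p q = (-1) ^+ e0 p * (-1) ^+ e1 q * bil_diff s p q.
Proof.
rewrite /bil_diff !big_bool !permM !flip_permE /=.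
by case: (e0 p); case: (e1 q) => /=; rewrite ?expr0 ?expr1; ring.
Qed.

(** The same four permutations serve all [p] and [q], so norm bounds for the matrices [bil_on] pass
    to [bil_diff]. *)
Lemma bil_diffE s p q : bil_diff s p q =
  (bil_on s p q - bil_on (cflip true false * s)%g p q
   - bil_on (cflip false true * s)%g p q + bil_on (cflip true true * s)%g p q) / 4.
Proof.
rewrite /bil_diff /bil_on !big_bool !permM !flip_permE /=.
by rewrite ?expr0 ?expr1; congr (_ / _); ring.
Qed.

(** For injective [f], the vector equal to [w p] at both positions of pair [p] and to 0 elsewhere;
    testing on such vectors folds a matrix along the pairs. *)
Let spread (f : P * bool -> 'I_N) (w : P -> R) (i : 'I_N) : R :=
  \sum_t (f t == i)%:R * w t.1.

Let sum_spread f w (F : 'I_N -> R) :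
  \sum_i spread f w i * F i = \sum_p \sum_b w p * F (f (p, b)).
Proof.
rewrite pair_bigA /=.
under eq_bigr do rewrite mulr_suml.
rewrite exchange_big; apply: eq_bigr => -[p b] _ /=.
rewrite (bigD1 (f (p, b)))//= eqxx mul1r big1 ?addr0// => i.
by rewrite eq_sym => /negbTE->; rewrite !mul0r.
Qed.

Let sum_spread_sqr f w : injective f ->
  \sum_i spread f w i ^+ 2 = 2 * \sum_p w p ^+ 2.
Proof.
move=> fI; under eq_bigr do rewrite expr2.
rewrite sum_spread mulr_sumr; apply: eq_bigr => p _.
have E b : spread f w (f (p, b)) = w p.
  rewrite /spread (bigD1 (p, b))//= eqxx mul1r big1 ?addr0// => t tp.
  by rewrite (inj_eq fI) (negbTE tp) mul0r.
by rewrite big_bool !E /=; ring.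
Qed.

(** Apply [dB] to vectors constant on pairs: each squared norm doubles, whence the factor 4. *)
Let bil_on_bound s (u v : P -> R) :
  (\sum_p \sum_q u p * v q * bil_on s p q) ^+ 2 <=
  4 * B ^+ 2 * ((\sum_p u p ^+ 2) * (\sum_q v q ^+ 2)).
Proof.
pose f0 (t : P * bool) := pos (false, t.1, t.2).
pose f1 (t : P * bool) := pos (true, t.1, t.2).
have i0 : injective f0 by move=> [a b] [a' b'] /pos_inj[-> ->].
have i1 : injective f1 by move=> [a b] [a' b'] /pos_inj[-> ->].
have := dB s (spread f0 u) (spread f1 v).
rewrite !sum_spread_sqr//.
rewrite [X in X ^+ 2 <= _](_ : _ = \sum_p \sum_q u p * v q * bil_on s p q); last first.
  under eq_bigr => i _ do (under eq_bigr => j _ do rewrite -mulrA; rewrite -mulr_sumr).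
  rewrite sum_spread; apply: eq_bigr => p _.
  under eq_bigr => b _ do rewrite sum_spread mulr_sumr.
  rewrite exchange_big; apply: eq_bigr => q _ /=.
  by rewrite /bil_on !big_bool /=; ring.
by move/le_trans; apply; rewrite le_eqVlt; apply/orP; left; apply/eqP; ring.
Qed.

Let bil_diff_bound s (u v : P -> R) :
  (\sum_p \sum_q u p * v q * bil_diff s p q) ^+ 2 <=
  4 * B ^+ 2 * ((\sum_p u p ^+ 2) * (\sum_q v q ^+ 2)).
Proof.
pose X t := \sum_p \sum_q u p * v q * bil_on t p q.
have -> : \sum_p \sum_q u p * v q * bil_diff s p q =
    (X s - X (cflip true false * s)%g - X (cflip false true * s)%g +
     X (cflip true true * s)%g) / 4.
  rewrite /X -!sumrB -big_split mulr_suml; apply: eq_bigr => p _ /=.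
  rewrite -!sumrB -big_split mulr_suml; apply: eq_bigr => q _ /=.
  by rewrite bil_diffE; ring.
have XB t := bil_on_bound t u v.
have := XB s; have := XB (cflip true false * s)%g; have := XB (cflip false true * s)%g.
have := XB (cflip true true * s)%g; rewrite -!/(X _).
set M := 4 * _ * _; set a := X s; set b := X _; set c := X _; set e := X _.
have := sqr_ge0 (a + b); have := sqr_ge0 (a + c); have := sqr_ge0 (a - e).
have := sqr_ge0 (b - c); have := sqr_ge0 (b + e); have := sqr_ge0 (c + e).
by nra.
Qed.

(** Duality: choose [u] as the image of [v] under the matrix in [bil_diff_bound]. *)
Let bil_diff_op s (v : P -> R) :
  \sum_p (\sum_q bil_diff s p q * v q) ^+ 2 <= 4 * B ^+ 2 * \sum_q v q ^+ 2.
Proof.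
pose u p := \sum_q bil_diff s p q * v q.
have := bil_diff_bound s u v.
rewrite [X in X ^+ 2 <= _](_ : _ = \sum_p u p ^+ 2); last first.
  apply: eq_bigr => p _; rewrite [RHS]expr2 [X in _ = _ * X]/u mulr_sumr.
  by apply: eq_bigr => q _; ring.
have u0 : 0 <= \sum_p u p ^+ 2 by apply: sumr_ge0 => p _; rewrite sqr_ge0.
have v0 : 0 <= \sum_p v p ^+ 2 by apply: sumr_ge0 => p _; rewrite sqr_ge0.
move: u0; rewrite le_eqVlt => /predU1P[<- _|u0].
  by rewrite mulr_ge0// mulr_ge0// sqr_ge0.
by rewrite mulrCA expr2 ler_pM2l.
Qed.

(** Swapping all pairs of the class [false] preserves the law and negates every term. *)
Lemma mean_bil_diff : mean (fun s => \sum_p \sum_q bil_diff s p q) = 0.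
Proof.
rewrite mean_sum big1// => p _; rewrite mean_sum big1// => q _.
have := reindex_mean (fun s => bil_diff s p q)
  (@mulgI _ (pflip (fun=> true) (fun=> false))).
rewrite (eq_mean (G := fun s => -1 * bil_diff s p q)) => [|s /=]; last first.
  by rewrite bil_diff_flip expr1 expr0 mulr1.
by rewrite meanZ; lra.
Qed.

Lemma mgf_bil_diff (mu : R) : mu ^+ 2 * B ^+ 2 <= 40^-1 ->
  mean (fun s : 'S_N => expR (mu * \sum_p \sum_q bil_diff s p q)) <=
  mean (fun s : 'S_N => expR (20 / 9 * mu ^+ 2 *
    \sum_p \sum_q \sum_b \sum_c d (pos (false, p, b)) (pos (true, q, c))
       (s (pos (false, p, b))) (s (pos (true, q, c))) ^+ 2)).
Proof.
move=> hmu.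
pose H s := \sum_p \sum_q bil_on s p q ^+ 2.
pose E s := expR (5 / 9 * mu ^+ 2 * H s).
apply: (@le_trans _ _ (mean E)); last first.
  apply: ler_mean => s; rewrite ler_expR.
  have -> : 20 / 9 * mu ^+ 2 = 5 / 9 * mu ^+ 2 * 4 by field.
  rewrite -[leRHS]mulrA ler_wpM2l//; first by rewrite mulr_ge0 ?sqr_ge0.
  rewrite mulr_sumr; apply: ler_sum => p _; rewrite mulr_sumr; apply: ler_sum => q _.
  rewrite /bil_on !big_bool /=.
  set a := d _ _ _ _; set b := d _ _ _ _; set c := d _ _ _ _; set e := d _ _ _ _.
  have := sqr_ge0 (a - b); have := sqr_ge0 (a - c); have := sqr_ge0 (a - e).
  have := sqr_ge0 (b - c); have := sqr_ge0 (b - e); have := sqr_ge0 (c - e).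
  by nra.
pose F s := expR (mu * \sum_p \sum_q bil_diff s p q).
have -> : mean (fun s => expR (mu * \sum_p \sum_q bil_diff s p q)) =
    mean (fun s : 'S_N => mean (fun e0 : {ffun P -> bool} => mean (fun e1 : {ffun P -> bool} =>
      F (pflip e0 e1 * s)%g))).
  have T0 : (0 < #|{ffun P -> bool}|)%N by apply/card_gt0P; exists [ffun=> true].
  under [RHS]eq_mean do rewrite exchange_mean.
  rewrite exchange_mean -[LHS](mean_cst _ T0); apply: eq_mean => e1.
  rewrite exchange_mean -[LHS](mean_cst _ T0); apply: eq_mean => e0.
  by rewrite -[LHS](reindex_mean F (@mulgI _ (pflip e0 e1))).
have Et (t : 'S_N) : mean (fun s => E (t * s)%g) = mean E.
  by rewrite -[RHS](reindex_mean E (@mulgI _ t)).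
have -> : mean E = mean (fun s : 'S_N => 4^-1 * (E s + E (cflip true false * s)%g +
    E (cflip false true * s)%g + E (cflip true true * s)%g)).
  rewrite meanZ 3!meanD (Et (cflip true false)) (Et (cflip false true)).
  by rewrite (Et (cflip true true)) -[mean (fun x => E x)]/(mean E); lra.
apply: ler_mean => s.
under eq_mean do under eq_mean do rewrite /F;
under eq_mean do under eq_mean do under eq_bigr do under eq_bigr do rewrite bil_diff_flip.
(* The squared operator norm is at most [4 B^2], so [mu^2 / 2 * 4 B^2 <= 1/20]; dividing by
   [1 - 2/20] turns [mu^2 / 2] into [5/9 mu^2]. *)
apply: le_trans (@rad_bilinear _ _ _ (bil_diff s) mu (4 * B ^+ 2) 20^-1 _ _ _ _) _ => //.
- by lra.
- by lra.
have -> : mu ^+ 2 / 2 * (\sum_p \sum_q bil_diff s p q ^+ 2) / (1 - 2 * 20^-1) =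
    5 / 9 * mu ^+ 2 * \sum_p \sum_q bil_diff s p q ^+ 2 by field.
have HS : \sum_p \sum_q bil_diff s p q ^+ 2 <= 4^-1 * (H s + H (cflip true false * s)%g +
    H (cflip false true * s)%g + H (cflip true true * s)%g).
  rewrite /H -!big_split mulr_sumr; apply: ler_sum => p _.
  rewrite -!big_split mulr_sumr; apply: ler_sum => q _ /=.
  rewrite bil_diffE.
  set a := bil_on _ _ _; set b := bil_on _ _ _; set c := bil_on _ _ _; set e := bil_on _ _ _.
  have := sqr_ge0 (a + b); have := sqr_ge0 (a + c); have := sqr_ge0 (a - e).
  have := sqr_ge0 (b - c); have := sqr_ge0 (b + e); have := sqr_ge0 (c + e).
  by nra.
(* Jensen over the four class swaps matches the form given to [mean E] above. *)
pose K (x : bool * bool) := 5 / 9 * mu ^+ 2 * H (if x.1 then (cflip true x.2 * s)%g else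
  if x.2 then (cflip false true * s)%g else s).
have K4 (G : bool * bool -> R) : mean G =
    4^-1 * (G (false, false) + G (true, false) + G (false, true) + G (true, true)).
  rewrite /mean card_prod card_bool; congr (_ * _).
  rewrite (eq_bigr (fun x => G (x.1, x.2))) => [|[]//].
  by rewrite -(pair_bigA _ (fun a b => G (a, b))) /= !big_bool /=; ring.
apply: (@le_trans _ _ (expR (mean K))).
  rewrite ler_expR K4 /K /=.
  have : 0 <= 5 / 9 * mu ^+ 2 by rewrite mulr_ge0 ?sqr_ge0.
  by move=> /ler_wpM2l/(_ _ _ HS); lra.
apply: le_trans (expR_mean K _) _; first by rewrite card_prod card_bool.
by rewrite K4 /K.
Qed.

End BilinearFlips.

(** * Consequences of the operator norm bound *)

Section OperatorBound.
Context {R : realType} {N : nat}.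
Variables (d : tensor4 R N) (B : R).
Hypothesis B0 : 0 <= B.
Hypothesis dB : forall (s : 'S_N) (u v : 'I_N -> R),
  (\sum_i \sum_j u i * v j * d i j (s i) (s j)) ^+ 2 <=
  B ^+ 2 * ((\sum_i u i ^+ 2) * (\sum_j v j ^+ 2)).

Let sum_delta (i : 'I_N) (F : 'I_N -> R) : \sum_k (k == i)%:R * F k = F i.
Proof.
rewrite (bigD1 i)//= eqxx mul1r big1 ?addr0// => k /negbTE->.
by rewrite mul0r.
Qed.

Let sum_delta_sqr (i : 'I_N) : \sum_k (k == i)%:R ^+ 2 = 1 :> R.
Proof. by under eq_bigr do rewrite expr2; rewrite sum_delta eqxx. Qed.

(** Test [dB] on the unit vector at [i] against the row itself. *)
Lemma row_bound (s : 'S_N) i : \sum_j d i j (s i) (s j) ^+ 2 <= B ^+ 2.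
Proof.
set S := \sum_j _.
have S0 : 0 <= S by apply: sumr_ge0 => j _; rewrite sqr_ge0.
have := dB s (fun k => (k == i)%:R) (fun j => d i j (s i) (s j)).
rewrite sum_delta_sqr mul1r -/S.
under eq_bigr => k _ do (under eq_bigr => j _ do rewrite -mulrA; rewrite -mulr_sumr).
rewrite sum_delta; under eq_bigr do rewrite -expr2.
rewrite -/S; move: S0; rewrite le_eqVlt => /predU1P[<- _|S0]; first by rewrite sqr_ge0.
by rewrite expr2 ler_pM2r.
Qed.

Lemma col_bound (s : 'S_N) j : \sum_i d i j (s i) (s j) ^+ 2 <= B ^+ 2.
Proof.
set S := \sum_i _.
have S0 : 0 <= S by apply: sumr_ge0 => i _; rewrite sqr_ge0.
have := dB s (fun i => d i j (s i) (s j)) (fun k => (k == j)%:R).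
rewrite sum_delta_sqr mulr1 -/S.
under eq_bigr => i _ do under eq_bigr => k _ do rewrite [d i j _ _ * _]mulrC -mulrA.
under eq_bigr => i _ do rewrite sum_delta -expr2.
rewrite -/S; move: S0; rewrite le_eqVlt => /predU1P[<- _|S0]; first by rewrite sqr_ge0.
by rewrite expr2 ler_pM2r.
Qed.

Lemma entry_bound (s : 'S_N) i j : `|d i j (s i) (s j)| <= B.
Proof.
rewrite -ler_sqr ?nnegrE// real_normK ?num_real//; apply: le_trans (row_bound s i).
by rewrite (bigD1 j)//= lerDl sumr_ge0// => k _; rewrite sqr_ge0.
Qed.

Lemma diag_entry_bound i k : `|d i i k k| <= B.
Proof. by have := entry_bound (tperm i k) i i; rewrite tpermL. Qed.

(** Extension by zero: sums over all four indices then reproduce the restricted sum in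
    [tensor_V]. *)
Definition offdiag_sqr (i j k l : 'I_N) : R :=
  if (i != j) && (k != l) then d i j k l ^+ 2 else 0.

Lemma offdiag_sqr_ge0 i j k l : 0 <= offdiag_sqr i j k l.
Proof. by rewrite /offdiag_sqr; case: ifP => // _; rewrite sqr_ge0. Qed.

Lemma offdiag_sqr_perm i j (s : 'S_N) : i != j ->
  offdiag_sqr i j (s i) (s j) = d i j (s i) (s j) ^+ 2.
Proof. by move=> ij; rewrite /offdiag_sqr ij (inj_eq perm_inj) ij. Qed.

Lemma offdiag_sqr_le i j (s : 'S_N) : offdiag_sqr i j (s i) (s j) <= d i j (s i) (s j) ^+ 2.
Proof.
case: (eqVneq i j) => [->|ij]; last by rewrite offdiag_sqr_perm.
by rewrite /offdiag_sqr eqxx sqr_ge0.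
Qed.

Lemma mean_offdiag (i j : 'I_N) (F : 'I_N -> 'I_N -> R) : i != j ->
  mean (fun s : 'S_N => F (s i) (s j) * d i j (s i) (s j) ^+ 2) =
  (N * N.-1)%:R^-1 * \sum_k \sum_l F k l * offdiag_sqr i j k l.
Proof.
move=> ij; rewrite (mean2 (fun k l => F k l * d i j k l ^+ 2) ij).
congr (_ * _); apply: eq_bigr => k _; rewrite big_mkcond; apply: eq_bigr => l _.
by rewrite /offdiag_sqr ij eq_sym; case: eqP; rewrite ?mulr0.
Qed.

(** Average [col_bound] over the event [s j = l], which has probability [1 / N], while each pair
    [(k, l)] of distinct values has weight [1 / (N (N - 1))]. *)
Lemma col_mean_bound (j l : 'I_N) : (1 < N)%N ->
  \sum_i \sum_k offdiag_sqr i j k l <= N%:R * B ^+ 2.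
Proof.
move=> N1.
have c0 : 0 < (N * N.-1)%:R :> R by rewrite ltr0n muln_gt0; lia.
have Ni : N%:R != 0 :> R by rewrite pnatr_eq0; lia.
rewrite -(@ler_pM2l _ (N * N.-1)%:R^-1) ?invr_gt0//.
apply: (@le_trans _ _ (mean (fun s : 'S_N => B ^+ 2 * (s j == l)%:R))); last first.
  rewrite meanZ (mean1 j (fun k => (k == l)%:R)).
  rewrite (eq_bigr (fun k => (k == l)%:R * 1)) => [|k _]; last by rewrite mulr1.
  rewrite sum_delta mulr1 natrM invfM.
  have e : N.-1%:R != 0 :> R by rewrite pnatr_eq0; lia.
  have -> : N%:R^-1 * N.-1%:R^-1 * (N%:R * B ^+ 2) = B ^+ 2 * N.-1%:R^-1 by field; rewrite Ni e.
  by rewrite ler_wpM2l ?sqr_ge0// lef_pV2 ?posrE ?ltr0n ?ler_nat; lia.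
have -> : (N * N.-1)%:R^-1 * \sum_i \sum_k offdiag_sqr i j k l =
   mean (fun s : 'S_N => \sum_(i | i != j) (s j == l)%:R * d i j (s i) (s j) ^+ 2).
  rewrite mean_sum mulr_sumr [LHS](bigD1 j)//=.
  rewrite big1 ?mulr0 ?add0r => [|k _]; last by rewrite /offdiag_sqr eqxx.
  apply: eq_bigr => i ij; rewrite (mean_offdiag (fun _ m => (m == l)%:R) ij).
  by congr (_ * _); apply: eq_bigr => k _; rewrite sum_delta.
apply: ler_mean => s; rewrite -mulr_sumr mulrC; case: eqP => _ /=; last by rewrite !mulr0.
rewrite !mulr1; apply: le_trans (col_bound s j).
by rewrite [leRHS](bigD1 j)//= lerDr sqr_ge0.
Qed.

Section BilinearMgf.
Context {P : finType}.
Variable pos : (bool * P) * bool -> 'I_N.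
Hypothesis pos_inj : injective pos.
Hypothesis cardP : (5 * #|P| <= N)%N.
Hypothesis N0 : (1 < N)%N.

Let side (c : bool) : {set 'I_N} := [set pos (c, t.1, t.2) | t : P * bool]%SET.

Let card_side c : (#|side c| <= 2 * #|P|)%N.
Proof. by apply: leq_trans (leq_imset_card _ _) _; rewrite card_prod card_bool mulnC. Qed.

Let sum_side c (F : 'I_N -> R) : \sum_p \sum_b F (pos (c, p, b)) = \sum_(i in side c) F i.
Proof.
rewrite pair_bigA big_imset//= => -[p b] [p' b'] _ _ /pos_inj [-> ->] //.
Qed.

Let side_disj : [disjoint side false & side true].
Proof.
rewrite -setI_eq0; apply/eqP/setP => i; rewrite !inE; apply/negP => /andP[].
by move=> /imsetP[t _ ->] /imsetP[t' _ /pos_inj].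
Qed.

(** Two rounds of [peel]. The first has at least [N / 5] free positions, hence the rate [6 / N]; the
    second has at least [3 N / 5], hence [2 / N]. Together with 20/9 this gives 80/3. *)
Lemma mgf_bil_bound (mu : R) : mu ^+ 2 * B ^+ 2 <= 100^-1 ->
  mean (fun s : 'S_N => expR (mu * \sum_p \sum_q bil_diff pos d s p q)) <=
  expR (80 / 3 * mu ^+ 2 * ((N%:R ^+ 2)^-1 *
     \sum_i \sum_j \sum_k \sum_l offdiag_sqr i j k l)).
Proof.
move=> hmu; set th := 20 / 9 * mu ^+ 2.
have th0 : 0 <= th by rewrite mulr_ge0 ?sqr_ge0.
(* The second round needs 1/36: the rate [6 / N] and a column sum of at most [N B^2] make each
   exponent at most [6 th B^2], to be bounded by 1/6. *)
have thB : th * B ^+ 2 <= 36^-1 by rewrite /th -mulrA; lra.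
have Np : 0 < N%:R :> R by rewrite ltr0n; lia.
apply: le_trans (@mgf_bil_diff _ _ _ pos pos_inj d B dB mu _) _; first by lra.
rewrite -/th.
pose y i (s : 'S_N) k := th * \sum_(j in side true) offdiag_sqr i j k (s j).
apply: (@le_trans _ _ (mean (fun s => expR (\sum_(i in side false) y i s (s i))))).
  apply: ler_mean => s; rewrite ler_expR -mulr_sumr ler_wpM2l// -sum_side.
  apply: ler_sum => p _; rewrite exchange_big; apply: ler_sum => b _.
  rewrite -sum_side; apply: ler_sum => q _; apply: ler_sum => c _.
  by rewrite offdiag_sqr_perm// (inj_eq pos_inj).
have hc0 := card_side false; have hc1 := card_side true.
have hr : 6 / 5 <= 6 / N%:R * (N - #|side false| - #|side true|)%:R :> R.
  rewrite -mulrA ler_pM2l// mulrC ler_pdivlMr// mulrC ler_pdivrMr//.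
  by rewrite -natrM ler_nat; lia.
(* First the images of one side are averaged out, given those of the other. *)
apply: le_trans (@peel _ _ (side true) y _ _ (side false) (6 / N%:R) side_disj _ hr) _.
- move=> i x z s k xJ zJ; congr (_ * _); apply: eq_bigr => j jJ.
  rewrite permM tpermD//; first by apply: contraNneq xJ => ->.
  by apply: contraNneq zJ => ->.
- by move=> i s k; rewrite mulr_ge0// sumr_ge0// => j _; apply: offdiag_sqr_ge0.
- move=> i s z iI zJ; apply: (@le_trans _ _ (th * B ^+ 2)); last by lra.
  rewrite ler_wpM2l//; have iJ := disjointFr side_disj iI.
  (* The trial value [s z] is the image of [i] after swapping [i] and [z], and the images of the
     other side do not move; so [row_bound] applies to the swapped permutation. *)
  apply: (@le_trans _ _ (\sum_(j in side true)
      offdiag_sqr i j ((tperm i z * s)%g i) ((tperm i z * s)%g j))).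
    apply: ler_sum => j jJ; rewrite !permM tpermL tpermD//.
      by apply: contraTneq jJ => <-; rewrite iJ.
    by apply: contraNneq zJ => ->.
  apply: le_trans (row_bound (tperm i z * s)%g i).
  rewrite [leRHS](bigID (mem (side true)))/= -[leLHS]addr0 lerD//.
    by apply: ler_sum => j _; apply: offdiag_sqr_le.
  by apply: sumr_ge0 => j _; rewrite sqr_ge0.
(* In the second round the exponents no longer depend on other images, so no position is held
   fixed. *)
pose v j (s : 'S_N) l := 6 / N%:R * (th * \sum_(i in side false) \sum_k offdiag_sqr i j k l).
have sub_sum j l : \sum_(i in side false) \sum_k offdiag_sqr i j k l <=
    \sum_i \sum_k offdiag_sqr i j k l.
  rewrite [leRHS](bigID (mem (side false)))/= lerDl sumr_ge0// => i _.
  by apply: sumr_ge0 => k _; apply: offdiag_sqr_ge0.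
have sub_ge0 j l : 0 <= \sum_(i in side false) \sum_k offdiag_sqr i j k l.
  by apply: sumr_ge0 => i _; apply: sumr_ge0 => k _; apply: offdiag_sqr_ge0.
apply: (@le_trans _ _ (mean (fun s : 'S_N => expR (\sum_(j in side true) v j s (s j))))).
  apply: ler_mean => s; rewrite ler_expR -mulr_sumr ler_wpM2l// ?divr_ge0//.
  rewrite -mulr_sumr; under eq_bigr do rewrite -mulr_sumr.
  rewrite -mulr_sumr ler_wpM2l// [leRHS]exchange_big; apply: ler_sum => i _ /=.
  by rewrite exchange_big.
have hr2 : 6 / 5 <= 2 / N%:R * (N - #|side true| - #|(finset.set0 : {set 'I_N})|)%:R :> R.
  have h : 3 * N%:R <= 5 * (N - #|side true|)%:R :> R.
    by rewrite -!natrM ler_nat; lia.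
  by rewrite cards0 subn0 mulrAC ler_pdivlMr//; lra.
apply: le_trans (@peel _ _ (finset.set0 : {set 'I_N}) v _ _ (side true) (2 / N%:R) _ _ hr2) _.
- by [].
- by move=> j s l; rewrite mulr_ge0 ?divr_ge0// mulr_ge0.
- by rewrite -setI_eq0 finset.setI0.
- move=> j s z _ _.
  apply: (@le_trans _ _ (6 / N%:R * (th * (N%:R * B ^+ 2)))).
    rewrite ler_wpM2l ?divr_ge0// ler_wpM2l//.
    exact: le_trans (sub_sum _ _) (col_mean_bound _ _ N0).
  have -> : 6 / N%:R * (th * (N%:R * B ^+ 2)) = 6 * (th * B ^+ 2).
    by field; rewrite gt_eqF.
  by lra.
apply: (@le_trans _ _ (mean (fun _ : 'S_N => expR (80 / 3 * mu ^+ 2 * ((N%:R ^+ 2)^-1 *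
     \sum_i \sum_j \sum_k \sum_l offdiag_sqr i j k l))))); last first.
  by rewrite mean_cst// card_perm_gt0.
apply: ler_mean => s; rewrite ler_expR.
have -> : 80 / 3 * mu ^+ 2 * ((N%:R ^+ 2)^-1 * \sum_i \sum_j \sum_k \sum_l offdiag_sqr i j k l) =
   2 / N%:R * (6 / N%:R * (th * \sum_i \sum_j \sum_k \sum_l offdiag_sqr i j k l)).
  by rewrite /th; field; rewrite gt_eqF.
rewrite ler_wpM2l ?divr_ge0//.
under eq_bigr do rewrite -mulr_sumr; rewrite -mulr_sumr ler_wpM2l ?divr_ge0//.
under eq_bigr do rewrite -mulr_sumr; rewrite -mulr_sumr ler_wpM2l//.
rewrite exchange_big /=.
apply: (@le_trans _ _ (\sum_j \sum_(i in side false) \sum_k \sum_l offdiag_sqr i j k l)).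
  rewrite [leRHS](bigID (mem (side true)))/= -[leLHS]addr0; apply: lerD.
    rewrite [leLHS]exchange_big; apply: ler_sum => j _ /=.
    rewrite [leLHS]exchange_big; apply: ler_sum => i _ /=.
    by rewrite exchange_big.
  do 4 (apply: sumr_ge0 => ? _); exact: offdiag_sqr_ge0.
rewrite [leRHS]exchange_big; apply: ler_sum => j _ /=.
rewrite [leRHS](bigID (mem (side false)))/= lerDl.
do 3 (apply: sumr_ge0 => ? _); exact: offdiag_sqr_ge0.
Qed.

End BilinearMgf.

End OperatorBound.

(** * Exponential moments of linear statistics *)

Section LinearMgf.
Context {R : realType} {N : nat} {Z : finType}.
Variable pos : Z * bool -> 'I_N.
Hypothesis pos_inj : injective pos.
Hypothesis cardZ : (5 * #|Z| <= 2 * N)%N.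
Hypothesis N0 : (0 < N)%N.

(** One round of [peel] after [mgf_lin_diff]: the pairs use at most [4 N / 5] positions, hence the
    rate [6 / N]. *)
Lemma mgf_lin_bound (g : 'I_N -> 'I_N -> R) (M mu : R) :
  (forall i k, g i k ^+ 2 <= M) -> mu ^+ 2 * M <= 6^-1 ->
  mean (fun s : 'S_N => expR (mu * \sum_z lin_diff pos g s z)) <=
  expR (6 * mu ^+ 2 * (N%:R^-1 * \sum_i \sum_k g i k ^+ 2)).
Proof.
move=> gM hmu; apply: le_trans (mgf_lin_diff pos_inj g mu) _.
pose I := [set pos z | z : Z * bool]%SET.
have cI : (#|I| <= 2 * #|Z|)%N.
  by apply: leq_trans (leq_imset_card _ _) _; rewrite card_prod card_bool mulnC.
pose y i (s : 'S_N) k := mu ^+ 2 * g i k ^+ 2.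
have Np : 0 < N%:R :> R by rewrite ltr0n.
have hr : 6 / 5 <= 6 / N%:R * (N - #|I| - #|(finset.set0 : {set 'I_N})|)%:R :> R.
  rewrite cards0 subn0 -mulrA ler_pM2l// mulrC ler_pdivlMr// mulrC ler_pdivrMr//.
  by rewrite -natrM ler_nat; lia.
have -> : mean (fun s : 'S_N => expR (mu ^+ 2 * \sum_z \sum_b g (pos (z, b)) (s (pos (z, b))) ^+ 2)) =
    mean (fun s => expR (\sum_(i in I) y i s (s i))).
  apply: eq_mean => s; congr expR; rewrite mulr_sumr big_imset /=; last first.
    by move=> ? ? _ _ /pos_inj.
  under eq_bigr do rewrite mulr_sumr.
  by rewrite pair_bigA; apply: eq_bigr => -[].
apply: le_trans (@peel _ _ (finset.set0 : {set 'I_N}) y _ _ I (6 / N%:R) _ _ hr) _.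
- by [].
- by move=> i s k; rewrite mulr_ge0 ?sqr_ge0.
- by rewrite -setI_eq0 finset.setI0.
- by move=> i s z _ _; apply: le_trans hmu; rewrite ler_wpM2l ?sqr_ge0.
apply: (@le_trans _ _ (mean (fun _ : 'S_N => expR (6 * mu ^+ 2 * (N%:R^-1 * \sum_i \sum_k g i k ^+ 2))))).
  apply: ler_mean => s; rewrite ler_expR.
  have -> : 6 * mu ^+ 2 * (N%:R^-1 * \sum_i \sum_k g i k ^+ 2) =
    6 / N%:R * (mu ^+ 2 * \sum_i \sum_k g i k ^+ 2) by ring.
  rewrite ler_wpM2l ?divr_ge0//; under eq_bigr do rewrite -mulr_sumr.
  rewrite -mulr_sumr ler_wpM2l ?sqr_ge0// [leRHS](bigID (mem I))/= lerDl.
  by do 2 (apply: sumr_ge0 => ? _); rewrite sqr_ge0.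
by rewrite mean_cst// card_perm_gt0.
Qed.

End LinearMgf.

(** * Consequences of degeneracy *)

Section Decomposition.
Context {R : realType} {N : nat}.

Let sum_notin (A : seq 'I_N) (F : 'I_N -> R) : uniq A ->
  \sum_(l | l \notin A) F l = \sum_l F l - \sum_(l <- A) F l.
Proof.
move=> uA; rewrite [X in X - _](bigID (mem A))/= -big_uniq//= big_mkcond /=.
by rewrite [RHS]addrC addKr -big_mkcond.
Qed.

(** Each restricted sum is a full sum minus the excluded terms, and degeneracy kills full sums over
    an index that occurs once. Summing over [l], [k], [j], [i] in turn leaves only coincident
    indices. For [g i j k l = d i j (s k) (s l)] the four remaining sums are [offdiag_stat],
    [swapped_stat], [diag_stat] and a constant. *)
Lemma degenerate_sum (g : tensor4 R N) : degenerate g ->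
  \sum_i \sum_(j | j \notin [:: i]) \sum_(k | k \notin [:: i; j])
     \sum_(l | l \notin [:: i; j; k])
       (g i j i j - g i j k j - g i j i l + g i j k l) =
  (N%:R ^+ 2 - 3 * N%:R + 1) * (\sum_i \sum_(j | j \notin [:: i]) g i j i j)
  + \sum_i \sum_(j | j \notin [:: i]) g i j j i
  - (2 * N%:R - 2) * (\sum_i g i i i i) + \sum_i \sum_k g i i k k.
Proof.
move=> dg.
have z4 i j k : \sum_l g i j k l = 0 by case: (dg i j k k).
have z3 i j l : \sum_k g i j k l = 0 by case: (dg i j l l).
have z2 i k l : \sum_j g i j k l = 0 by case: (dg i i k l).
have z1 j k l : \sum_i g i j k l = 0 by case: (dg j j k l).
have cst (c : R) : \sum_(l < N) c = N%:R * c by rewrite sumr_const card_ord mulr_natl.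
have S4 i j k : k \notin [:: i; j] -> j \notin [:: i] ->
    \sum_(l | l \notin [:: i; j; k]) (g i j i j - g i j k j - g i j i l + g i j k l) =
    (N%:R - 2) * (g i j i j - g i j k j) + g i j i i + g i j i k - g i j k i - g i j k k.
  rewrite !inE negb_or => /andP[ki kj] ji.
  have u : uniq [:: i; j; k].
    by rewrite /= !inE negb_or [i == j]eq_sym ji [i == k]eq_sym ki [j == k]eq_sym kj.
  rewrite sum_notin// big_split sumrB cst z4 z4 !big_cons !big_nil.
  by rewrite /=; ring.
have S3 i j : j \notin [:: i] ->
    \sum_(k | k \notin [:: i; j]) \sum_(l | l \notin [:: i; j; k])
      (g i j i j - g i j k j - g i j i l + g i j k l) =
    (N%:R ^+ 2 - 3 * N%:R + 1) * g i j i j + g i j j i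
    + (N%:R - 1) * (g i j i i + g i j j j) - \sum_k g i j k k.
  move=> ji; rewrite (eq_bigr _ (fun k kij => S4 i j k kij ji)).
  have u : uniq [:: i; j] by move: ji; rewrite /= !inE eq_sym => ->.
  rewrite sum_notin// !sumrB !big_split /= -mulr_sumr sumrB !cst z3 z4 z3 !big_cons !big_nil.
  by rewrite /=; ring.
have S2 i : \sum_(j | j \notin [:: i]) \sum_(k | k \notin [:: i; j])
      \sum_(l | l \notin [:: i; j; k]) (g i j i j - g i j k j - g i j i l + g i j k l) =
    (N%:R ^+ 2 - 3 * N%:R + 1) * (\sum_(j | j \notin [:: i]) g i j i j)
    + \sum_(j | j \notin [:: i]) g i j j i
    + (N%:R - 1) * (\sum_j g i j j j - 2 * g i i i i) + \sum_k g i i k k.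
  rewrite (eq_bigr _ (fun j ji => S3 i j ji)).
  rewrite sumrB !big_split /= -!mulr_sumr.
  rewrite big_split /= [\sum_(j | _) g i j i i]sum_notin// z2.
  rewrite [\sum_(j | _) g i j j j]sum_notin//.
  rewrite [\sum_(j | _) \sum_k g i j k k]sum_notin//.
  rewrite (exchange_big _ _ _ _ _ (fun j k => g i j k k)) /=.
  rewrite [X in _ - (X - _)]big1 => [|k _]; last exact: z2.
  by rewrite !big_seq1; ring.
rewrite (eq_bigr _ (fun i _ => S2 i)) !big_split /= -!mulr_sumr sumrB -mulr_sumr.
rewrite (exchange_big _ _ _ _ _ (fun i j => g i j j j)) /=.
rewrite [X in _ * (X - _)]big1 => [|k _]; last exact: z1.
by ring.
Qed.

End Decomposition.

(** * Averages over the choice of pairs *)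

Section Averages.
Context {R : realType} {N : nat}.

Lemma degenerate_perm (d : tensor4 R N) (s : 'S_N) :
  degenerate d -> degenerate (fun i j k l => d i j (s k) (s l)).
Proof.
move=> dd i j k l; have [h1 h2 h3 h4] := dd i j (s k) (s l).
split=> //.
- by rewrite -[RHS]h1 [RHS](reindex_inj (@perm_inj _ s)).
- by rewrite -[RHS]h2 [RHS](reindex_inj (@perm_inj _ s)).
Qed.

Definition offdiag_stat (d : tensor4 R N) (s : 'S_N) : R :=
  \sum_i \sum_(j | j \notin [:: i]) d i j (s i) (s j).

Definition swapped_stat (d : tensor4 R N) (s : 'S_N) : R :=
  \sum_i \sum_(j | j \notin [:: i]) d i j (s j) (s i).

Definition diag_stat (d : tensor4 R N) (s : 'S_N) : R := \sum_i d i i (s i) (s i).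

(** The positions of two pairs of different classes, moved by a uniform [k], are four distinct
    uniform indices. Hence each of the four differences [f b a] that make up [bil_diff] has the mean
    computed by [degenerate_sum]. *)
Lemma mean_bil_diff_pos (P : finType) (pos : (bool * P) * bool -> 'I_N)
    (d : tensor4 R N) (s : 'S_N) : injective pos -> degenerate d ->
  mean (fun k : 'S_N => \sum_p \sum_q bil_diff (fun z => k (pos z)) d s p q) =
  #|P|%:R ^+ 2 * (N * (N - 1) * (N - 2) * (N - 3))%:R^-1 *
  ((N%:R ^+ 2 - 3 * N%:R + 1) * offdiag_stat d s + swapped_stat d s
   - (2 * N%:R - 2) * diag_stat d s + \sum_i \sum_k d i i k k).
Proof.
move=> posI dd.
pose F i j k l := d i j (s i) (s j) - d i j (s k) (s j) - d i j (s i) (s l)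
  + d i j (s k) (s l).
set X := \sum_i \sum_k d i i k k.
have -> : X = \sum_i \sum_k d i i (s k) (s k).
  by apply: eq_bigr => i _; rewrite [LHS](reindex_inj (@perm_inj _ s)).
rewrite -[X in _ * X](degenerate_sum (degenerate_perm s dd)).
set S := \sum_i _; set c := (_ * _)%:R^-1.
have E p q : mean (fun k : 'S_N => bil_diff (fun z => k (pos z)) d s p q) = c * S.
  pose f b a (k : 'S_N) := F (k (pos (false, p, b))) (k (pos (true, q, a)))
          (k (pos (false, p, ~~ b))) (k (pos (true, q, ~~ a))).
  have fE b a : mean (fun k => f b a k) = c * S.
    by apply: mean4; rewrite /= !inE !(inj_eq posI); case: b; case: a;
      rewrite !xpair_eqE /= ?andbF.
  transitivity (mean (fun k => 4^-1 * (f true true k + f true false k +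
      f false true k + f false false k))).
    apply: eq_mean => k; rewrite /bil_diff /f /F !big_bool /=.
    by rewrite ?expr0 ?expr1; ring.
  by rewrite meanZ 3!meanD !fE; field.
rewrite mean_sum; under eq_bigr do rewrite mean_sum.
under eq_bigr do under eq_bigr do rewrite E.
by rewrite !sumr_const -mulrnA -[_ *+ (_ * _)%N]mulr_natl natrM; ring.
Qed.

(** A random pair consists of two distinct uniform indices; vanishing row sums of [g] remove the
    cross terms. *)
Lemma mean_lin_diff_pos (Z : finType) (pos : Z * bool -> 'I_N)
    (g : 'I_N -> 'I_N -> R) (s : 'S_N) : injective pos -> (1 < N)%N ->
  (forall i, \sum_k g i k = 0) ->
  mean (fun k : 'S_N => \sum_z lin_diff (fun z => k (pos z)) g s z) =
  #|Z|%:R / N.-1%:R * \sum_i g i (s i).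
Proof.
move=> posI N1 g0.
pose F i j := g i (s i) - g i (s j).
have n0 : N%:R != 0 :> R by rewrite pnatr_eq0; lia.
have n1 : N.-1%:R != 0 :> R by rewrite pnatr_eq0; lia.
have nE : N%:R = N.-1%:R + 1 :> R by rewrite natr1 prednK//; lia.
have gs i : \sum_j g i (s j) = 0.
  by rewrite -[RHS](g0 i) [RHS](reindex_inj (@perm_inj _ s)).
have FE : \sum_i \sum_(j | j != i) F i j = N%:R * \sum_i g i (s i).
  rewrite mulr_sumr; apply: eq_bigr => i _.
  transitivity (\sum_j F i j); first by rewrite [RHS](bigD1 i)//= /F subrr add0r.
  rewrite /F sumrB sumr_const card_ord -[g i (s i) *+ N]mulr_natl.
  by rewrite gs subr0.
have E z : mean (fun k : 'S_N => lin_diff (fun z => k (pos z)) g s z) =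
    N.-1%:R^-1 * \sum_i g i (s i).
  pose f b (k : 'S_N) := F (k (pos (z, b))) (k (pos (z, ~~ b))).
  have fE b : mean (fun k => f b k) = N.-1%:R^-1 * \sum_i g i (s i).
    rewrite (mean2 F) ?FE; first by rewrite natrM; field; rewrite ?n0 ?n1.
    by rewrite (inj_eq posI) xpair_eqE eqxx; case: b.
  transitivity (mean (fun k => 2^-1 * (f true k + f false k))).
    by apply: eq_mean => k; rewrite /lin_diff /f /F /=; ring.
  by rewrite meanZ meanD !fE; field.
rewrite mean_sum; under eq_bigr do rewrite E.
by rewrite sumr_const -[LHS]mulr_natl mulrA.
Qed.

End Averages.

(** * The moment generating function over permutations *)

Section Assembly.
Context {R : realType}.

(** The weights 2/3, 1/6, 1/6 explain the factors 3/2, 6, 6 in the exponents of the three parts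
    below. *)
Lemma expR_convex3 (x y z : R) :
  expR (2 / 3 * x + 6^-1 * y + 6^-1 * z) <=
  2 / 3 * expR x + 6^-1 * expR y + 6^-1 * expR z.
Proof.
set a := _ + _ + _.
have hx := expR_ge_tangent a x; have hy := expR_ge_tangent a y.
have hz := expR_ge_tangent a z.
have : expR a = 2 / 3 * (expR a * (1 + (x - a))) + 6^-1 * (expR a * (1 + (y - a)))
   + 6^-1 * (expR a * (1 + (z - a))) by rewrite /a; field.
by lra.
Qed.

Lemma mgf_mean (S T : finType) (G : T -> S -> R) (mu b : R) : (0 < #|T|)%N ->
  (forall k, mean (fun s => expR (mu * G k s)) <= b) ->
  mean (fun s => expR (mu * mean (G^~ s))) <= b.
Proof.
move=> T0 H.
apply: (@le_trans _ _ (mean (fun s => mean (fun k => expR (mu * G k s))))).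
  by apply: ler_mean => s; rewrite -meanZ; apply: expR_mean.
rewrite exchange_mean -[leRHS](@mean_cst _ T)//.
exact: ler_mean.
Qed.

(** Second-order expansion by [expR_le_sqr]: the linear term averages to zero and the variance is at
    most the second moment. *)
Lemma mgf_centered_small (T : finType) (F : T -> R) (c M : R) : (0 < #|T|)%N ->
  (forall s, `|F s| <= M) -> 2 * `|c| * M <= 3^-1 ->
  mean (fun s => expR (c * (F s - mean F))) <= expR (c ^+ 2 * mean (fun s => F s ^+ 2)).
Proof.
move=> T0 FM cM; set m := mean F.
have mM : `|m| <= M.
  rewrite ler_norml -[X in X <= m](mean_cst _ T0) -[X in _ && (m <= X)](mean_cst _ T0).
  by apply/andP; split; apply: ler_mean => s; have := FM s; rewrite ler_norml => /andP[].
apply: (@le_trans _ _ (mean (fun s => 1 + c * (F s - m) + (c * (F s - m)) ^+ 2))).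
  apply: ler_mean => s; apply: expR_le_sqr; rewrite normrM.
  apply: le_trans cM; rewrite [2 * _]mulrC -mulrA ler_wpM2l//.
  by apply: le_trans (ler_normB _ _) _; have := FM s; lra.
have -> : mean (fun s => 1 + c * (F s - m) + (c * (F s - m)) ^+ 2) =
    1 + c ^+ 2 * (mean (fun s => F s ^+ 2) - m ^+ 2).
  transitivity (mean (fun s => (1 - c * m + c ^+ 2 * m ^+ 2) +
      ((c - 2 * c ^+ 2 * m) * F s + c ^+ 2 * F s ^+ 2))).
    by apply: eq_mean => s; ring.
  rewrite (meanD (fun=> _) (fun s => _ * F s + _)) mean_cst//.
  by rewrite (meanD (fun s => _ * F s)) 2!meanZ -/m; ring.
apply: le_trans (expR_ge1Dx _) _; rewrite ler_expR ler_wpM2l ?sqr_ge0//.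
by rewrite gerBl sqr_ge0.
Qed.

(** * Bilinear, linear and swapped parts of the quadratic statistic *)

Section Perm.
Context {N : nat}.
Variables (d : tensor4 R N) (B : R).
Hypothesis N20 : (20 <= N)%N.
Hypothesis dd : degenerate d.
Hypothesis B0 : 0 <= B.
Hypothesis dB : forall (s : 'S_N) (u v : 'I_N -> R),
  (\sum_i \sum_j u i * v j * d i j (s i) (s j)) ^+ 2 <=
  B ^+ 2 * ((\sum_i u i ^+ 2) * (\sum_j v j ^+ 2)).

Let x : R := N%:R.
(** The number of pairs in each class: two classes use [4 n] positions and leave at least a fifth
    free. *)
Let n := (N %/ 5)%N.
Let m : R := n%:R.
Let n5 : (5 * n <= N)%N. Proof. by rewrite mulnC leq_trunc_div. Qed.
Let x20 : 20 <= x. Proof. by rewrite (ler_nat R 20). Qed.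
Let m4 : 4 <= m. Proof. by rewrite (ler_nat R 4) /n; lia. Qed.
Let xm : x <= 5 * m + 4.
Proof. by rewrite -(natrM R 5) -(natrD R _ 4) ler_nat /n; lia. Qed.
Let K := x ^+ 2 - 3 * x + 1.
Let K1 : 1 <= K. Proof. by rewrite /K; have := x20; nra. Qed.
Let K0 : K != 0. Proof. by rewrite gt_eqF//; have := K1; lra. Qed.
Let m0 : m != 0. Proof. by rewrite gt_eqF//; have := m4; lra. Qed.
Let x0 : x != 0. Proof. by rewrite gt_eqF//; have := x20; lra. Qed.

Definition centered_diag_sqr : R := N%:R^-1 * \sum_i \sum_k tensor_xi d i k ^+ 2.
Definition offdiag_mean_sqr : R :=
  (N%:R ^+ 2)^-1 * \sum_i \sum_j \sum_k \sum_l offdiag_sqr d i j k l.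

Lemma tensor_VE : tensor_V d = centered_diag_sqr + offdiag_mean_sqr.
Proof.
rewrite /tensor_V /centered_diag_sqr /offdiag_mean_sqr; congr (_ + _ * _).
apply: eq_bigr => i _; rewrite big_mkcond; apply: eq_bigr => j _.
case: (eqVneq i j) => [<-|ij].
  by rewrite /= big1// => k _; rewrite big1// => l _; rewrite /offdiag_sqr eqxx.
apply: eq_bigr => k _; rewrite big_mkcond; apply: eq_bigr => l _.
by rewrite /offdiag_sqr ij.
Qed.

Lemma centered_diag_sqr_ge0 : 0 <= centered_diag_sqr.
Proof.
by rewrite mulr_ge0// sumr_ge0// => i _; rewrite sumr_ge0// => k _; rewrite sqr_ge0.
Qed.

Lemma offdiag_mean_sqr_ge0 : 0 <= offdiag_mean_sqr.
Proof.
rewrite mulr_ge0 ?invr_ge0 ?sqr_ge0//.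
by do 4 (apply: sumr_ge0 => ? _); apply: offdiag_sqr_ge0.
Qed.

Lemma xi_row_sum i : \sum_k tensor_xi d i k = 0.
Proof.
rewrite /tensor_xi big_split /= !sumrB /= -!mulr_sumr !sumr_const card_ord.
rewrite (exchange_big _ _ _ _ _ (fun k i' => d i' i' k k)) /=.
set a := \sum_k _; set b := \sum_i' _.
rewrite -[a *+ N]mulr_natl -[b *+ N]mulr_natl -/x.
by field; rewrite x0.
Qed.

Lemma xi_sqr_bound i k : tensor_xi d i k ^+ 2 <= 16 * B ^+ 2.
Proof.
have avg (F : 'I_N -> R) : (forall j, `|F j| <= B) -> `|N%:R^-1 * \sum_j F j| <= B.
  move=> FB; rewrite normrM ger0_norm ?invr_ge0 ?ler0n// ler_pdivrMl; last first.
    by have := x20; rewrite /x; lra.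
  apply: le_trans (ler_norm_sum _ _ _) _.
  apply: le_trans (ler_sum _ (fun j _ => FB j)) _.
  by rewrite sumr_const card_ord -[B *+ N]mulr_natl.
have e := diag_entry_bound B0 dB.
have h1 := e i k; have h2 := avg _ (fun k' => e i k'); have h3 := avg _ (fun i' => e i' k).
have h4 := avg _ (fun i' => avg _ (fun k' => e i' k')).
rewrite -mulr_sumr mulrA -invfM -expr2 in h4.
have h : `|tensor_xi d i k| <= 4 * B.
  rewrite /tensor_xi; apply: le_trans (ler_normD _ _) _.
  have := ler_normB (d i i k k - N%:R^-1 * \sum_(k' < N) d i i k' k')
    (N%:R^-1 * \sum_(i' < N) d i' i' k k).
  have := ler_normB (d i i k k) (N%:R^-1 * \sum_(k' < N) d i i k' k').
  by lra.
have -> : 16 * B ^+ 2 = (4 * B) ^+ 2 by ring.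
by rewrite -(real_normK (num_real (tensor_xi _ _ _))) lerXn2r ?nnegrE ?mulr_ge0.
Qed.

Lemma diag_stat_centered (s : 'S_N) :
  diag_stat d s - mean (diag_stat d) = \sum_i tensor_xi d i (s i).
Proof.
rewrite /diag_stat mean_sum.
under [X in _ - X]eq_bigr => i _ do rewrite (mean1 i (fun k => d i i k k)).
rewrite /tensor_xi big_split /= !sumrB -/x.
rewrite -[X in _ = _ - _ - X + _]mulr_sumr.
have -> : \sum_i \sum_(i' < N) d i' i' (s i) (s i) = \sum_i \sum_k d i i k k.
  rewrite exchange_big; apply: eq_bigr => i _.
  by rewrite [RHS](reindex_inj (@perm_inj _ s)).
rewrite -mulr_sumr sumr_const card_ord -[_ *+ N]mulr_natl -/x.
by field; rewrite x0.
Qed.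

Let card_pos : (#|{: (bool * 'I_n) * bool}| <= N)%N.
Proof. by rewrite !card_prod card_bool card_ord; move: n5; clearbody n; lia. Qed.

Let pos (z : (bool * 'I_n) * bool) : 'I_N := widen_ord card_pos (enum_rank z).

Let pos_inj : injective pos.
Proof. by move=> a b /(congr1 val) /= /val_inj/enum_rank_inj. Qed.

Let T0 : (0 < #|{: 'S_N}|)%N := card_perm_gt0 N.

(** The permutation [k] makes the choice of pairs random, independently of the argument [s] of the
    statistic. *)
Let kpos (k : 'S_N) z := k (pos z).
Let kpos_inj k : injective (kpos k).
Proof. by move=> a b /perm_inj/pos_inj. Qed.

Let Y (k s : 'S_N) := \sum_p \sum_q bil_diff (kpos k) d s p q.
Let Y' (k s : 'S_N) := \sum_z lin_diff (kpos k) (tensor_xi d) s z.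

Let c1 := x * (x - 1) * (x - 2) * (x - 3) / (K * m ^+ 2).
Let c2 := 1 + (2 * x - 2) / K.

Let quad_statE s : quad_stat d s = offdiag_stat d s + diag_stat d s.
Proof.
rewrite /offdiag_stat /diag_stat -big_split; apply: eq_bigr => i _ /=.
rewrite (bigD1 i)//= addrC; congr (_ + _).
by apply: eq_bigl => j; rewrite inE.
Qed.

(** Solve [mean_bil_diff_pos] for [offdiag_stat], whose coefficient there is proportional to [K],
    and add the diagonal. *)
Let quad_stat_decomp s : quad_stat d s = c1 * mean (Y^~ s) - K^-1 * swapped_stat d s
  + c2 * diag_stat d s - K^-1 * \sum_i \sum_k d i i k k.
Proof.
rewrite /Y (mean_bil_diff_pos s pos_inj dd) card_ord quad_statE -/m.
rewrite !natrM !natrB ?(leq_trans _ N20)// -/x -/K /c1 /c2.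
have h : x * (x - 1) * (x - 2) * (x - 3) != 0.
  by rewrite !mulf_neq0// gt_eqF//; have := x20; lra.
by field; rewrite K0 m0 /=; move: h; rewrite !mulf_eq0 !negb_or -!andbA => /and4P[-> -> -> ->].
Qed.

Let quad_stat_centered s : quad_stat d s - mean (quad_stat d) =
  c1 * mean (Y^~ s) - K^-1 * (swapped_stat d s - mean (swapped_stat d))
  + c2 * \sum_i tensor_xi d i (s i).
Proof.
have m1 : mean (fun s => mean (Y^~ s)) = 0.
  rewrite exchange_mean -[RHS](@mean_cst _ {: 'S_N})//.
  by apply: eq_mean => k; rewrite /= -[RHS](mean_bil_diff (@kpos_inj k) d).
have -> : mean (quad_stat d) = - K^-1 * mean (swapped_stat d)
  + c2 * mean (diag_stat d) - K^-1 * \sum_i \sum_k d i i k k.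
  rewrite (eq_mean quad_stat_decomp).
  rewrite (meanD (fun s => _ - _ + _)) (meanD (fun s => _ - _)) (meanD (fun s => c1 * _)).
  rewrite (meanZ c1 (fun s => mean (Y^~ s))) m1 (meanN (fun s => _ * _)).
  rewrite (meanZ K^-1 (swapped_stat d)) (meanZ c2 (diag_stat d)) mean_cst//.
  by ring.
by rewrite -diag_stat_centered quad_stat_decomp; ring.
Qed.

Let c1_ge0 : 0 <= c1.
Proof.
rewrite divr_ge0 ?mulr_ge0 ?sqr_ge0//; have := x20; have := K1; lra.
Qed.

Let c1_le : c1 <= 36.
Proof.
have := K1; have := m4; have := xm; have := x20; move=> hx hxm hm hK.
rewrite ler_pdivrMr; last by rewrite mulr_gt0 ?exprn_gt0//; lra.
(* Compare factor by factor: [(5 m + 4) (5 m + 3) <= 36 m^2] for [m >= 4], and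
   [(x - 2) (x - 3) <= K]. *)
have -> : x * (x - 1) * (x - 2) * (x - 3) = (x * (x - 1)) * ((x - 2) * (x - 3)) by ring.
have -> : 36 * (K * m ^+ 2) = (36 * m ^+ 2) * K by ring.
apply: ler_pM; [nra|nra| |rewrite /K; nra].
apply: (@le_trans _ _ ((5 * m + 4) * (5 * m + 3))); first by apply: ler_pM; lra.
by nra.
Qed.

Let c2_ge0 : 0 <= c2.
Proof. by rewrite addr_ge0// divr_ge0//; have := x20; have := K1; lra. Qed.

Let c2_le : c2 <= 6 / 5.
Proof.
rewrite /c2; suff : (2 * x - 2) / K <= 5^-1 by lra.
rewrite ler_pdivrMr; last by have := K1; lra.
by rewrite /K; have := x20; nra.
Qed.

Section Lambda.
Variable lam : R.
Hypothesis lam0 : 0 <= lam.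
Hypothesis lamB : 54 * 10 ^+ 2 * B * lam <= 1.

Let lamB0 : 0 <= lam * B. Proof. exact: mulr_ge0. Qed.

Let lamB1 : 10 ^+ 3 * (lam * B) <= 1.
Proof. by have := lamB0; move: lamB; lra. Qed.

Let lamB2 (c : R) : 10 ^+ 7 * ((c * lam) ^+ 2 * B ^+ 2) <= c ^+ 2.
Proof.
have h : (54 * 10 ^+ 2 * B * lam) ^+ 2 <= 1.
  by apply: exprn_ile1; rewrite ?lamB// -mulrA [B * _]mulrC mulr_ge0.
have -> : (c * lam) ^+ 2 * B ^+ 2 = c ^+ 2 * (lam * B) ^+ 2 by ring.
rewrite mulrCA -[X in _ <= X]mulr1 ler_wpM2l ?sqr_ge0//.
by have := sqr_ge0 (lam * B); lra.
Qed.

(* The numerical constants: [c1 <= 36] comes from N <= 5 n + 4 and n >= 4, and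
   80/3 * 54^2 = 77760 <= 10^5. *)
Let mgf_bilinear_part :
  mean (fun s => expR (3 / 2 * lam * c1 * mean (Y^~ s))) <=
  expR (10 ^+ 5 * offdiag_mean_sqr * lam ^+ 2).
Proof.
set mu := 3 / 2 * lam * c1.
have mu0 : 0 <= mu by rewrite mulr_ge0 ?c1_ge0// mulr_ge0.
have mule : mu <= 54 * lam.
  have := ler_wpM2l lam0 c1_le; rewrite /mu; lra.
have mu2 : mu ^+ 2 <= (54 * lam) ^+ 2 by rewrite lerXn2r ?nnegrE// mulr_ge0.
apply: mgf_mean => // k.
apply: le_trans (mgf_bil_bound B0 dB (@kpos_inj k) _ _ _) _.
- by rewrite card_ord.
- by rewrite (leq_trans _ N20).
- apply: (@le_trans _ _ ((54 * lam) ^+ 2 * B ^+ 2)); first by rewrite ler_wpM2r ?sqr_ge0.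
  by have := lamB2 54; lra.
rewrite ler_expR -/offdiag_mean_sqr.
have h := offdiag_mean_sqr_ge0.
apply: (@le_trans _ _ (80 / 3 * (54 * lam) ^+ 2 * offdiag_mean_sqr)).
  by rewrite ler_wpM2r// ler_wpM2l.
have : 0 <= lam ^+ 2 * offdiag_mean_sqr by rewrite mulr_ge0 ?sqr_ge0.
by lra.
Qed.

Let mgf_linear_part :
  mean (fun s : 'S_N => expR (6 * lam * c2 * \sum_i tensor_xi d i (s i))) <=
  expR (10 ^+ 5 * centered_diag_sqr * lam ^+ 2).
Proof.
(* The inverse of the factor in [mean_lin_diff_pos] for [2 n] pairs, both classes being used. *)
pose c3 := (x - 1) / (2 * m).
have c30 : 0 <= c3 by rewrite divr_ge0//; have := x20; have := m4; lra.
have c3le : c3 <= 3.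
  have := m4; have := xm => h1 h2; rewrite ler_pdivrMr; lra.
have xiE (s : 'S_N) : \sum_i tensor_xi d i (s i) = c3 * mean (Y'^~ s).
  rewrite /Y' (mean_lin_diff_pos s pos_inj _ xi_row_sum); last by rewrite (leq_trans _ N20).
  rewrite card_prod card_bool card_ord natrM -/m -subn1 natrB -/x; last by rewrite (leq_trans _ N20).
  have x1 : x - 1 != 0 by rewrite gt_eqF//; have := x20; lra.
  by rewrite /c3; field; rewrite m0 x1.
under eq_mean do rewrite xiE mulrA.
set mu := 6 * lam * c2 * c3.
have mu0 : 0 <= mu by rewrite mulr_ge0// mulr_ge0// mulr_ge0.
have mule : mu <= 108 / 5 * lam.
  have -> : 108 / 5 * lam = 6 * lam * (6 / 5) * 3 by field.
  apply: ler_pM; [by rewrite !mulr_ge0|exact: c30| |exact: c3le].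
  by apply: ler_wpM2l; [rewrite mulr_ge0|exact: c2_le].
have mu2 : mu ^+ 2 <= (108 / 5 * lam) ^+ 2.
  by apply: lerXn2r => //; rewrite nnegrE//; lra.
apply: mgf_mean => // k.
apply: le_trans (@mgf_lin_bound _ _ _ _ (@kpos_inj k) _ _ _ (16 * B ^+ 2) mu _ _) _.
- by rewrite card_prod card_bool card_ord mulnCA leq_mul2l n5.
- by rewrite (leq_trans _ N20).
- exact: xi_sqr_bound.
- rewrite mulrCA.
  apply: (@le_trans _ _ (16 * ((108 / 5 * lam) ^+ 2 * B ^+ 2))).
    by rewrite ler_wpM2l// ler_wpM2r ?sqr_ge0.
  by have := lamB2 (108 / 5); lra.
rewrite ler_expR -/centered_diag_sqr.
have h := centered_diag_sqr_ge0.
apply: (@le_trans _ _ (6 * (108 / 5 * lam) ^+ 2 * centered_diag_sqr)).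
  by rewrite ler_wpM2r// ler_wpM2l.
have : 0 <= lam ^+ 2 * centered_diag_sqr by rewrite mulr_ge0 ?sqr_ge0.
by lra.
Qed.

(** Off the diagonal, [d i j (s j) (s i)] is a matrix entry for [s] composed with the transposition
    of [i] and [j]. *)
Let swapped_bound s : `|swapped_stat d s| <= x ^+ 2 * B.
Proof.
have h i j : j \notin [:: i] -> `|d i j (s j) (s i)| <= B.
  rewrite inE eq_sym => ij; have := entry_bound B0 dB (tperm i j * s)%g i j.
  by rewrite !permM tpermL tpermR.
apply: le_trans (ler_norm_sum _ _ _) _.
apply: (@le_trans _ _ (\sum_(i < N) \sum_(j < N) B)).
  apply: ler_sum => i _; apply: le_trans (ler_norm_sum _ _ _) _.
  rewrite [leRHS](bigID [pred j | j \notin [:: i]])/= -[leLHS]addr0 lerD ?sumr_ge0//.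
  by apply: ler_sum => j; apply: h.
rewrite !sumr_const card_ord -[_ *+ N *+ N]mulr_natl -[B *+ N]mulr_natl -/x.
by rewrite expr2 mulrA.
Qed.

Let swapped_sqr : mean (fun s => swapped_stat d s ^+ 2) <= 2 * x ^+ 2 * offdiag_mean_sqr.
Proof.
have N1 : (1 < N)%N by rewrite (leq_trans _ N20).
apply: (@le_trans _ _ (mean (fun s : 'S_N => x ^+ 2 *
    \sum_i \sum_(j | j != i) d i j (s j) (s i) ^+ 2))).
  apply: ler_mean => s.
  pose F (t : 'I_N * 'I_N) := if t.2 != t.1 then d t.1 t.2 (s t.2) (s t.1) else 0.
  have -> : swapped_stat d s = \sum_t F t.
    rewrite -(pair_bigA _ (fun i j => F (i, j))) /=; apply: eq_bigr => i _.
    by rewrite big_mkcond; apply: eq_bigr => j _; rewrite inE.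
  have -> : \sum_i \sum_(j | j != i) d i j (s j) (s i) ^+ 2 = \sum_t F t ^+ 2.
    rewrite -(pair_bigA _ (fun i j => F (i, j) ^+ 2)) /=; apply: eq_bigr => i _.
    rewrite big_mkcond; apply: eq_bigr => j _; rewrite /F /=.
    by case: eqP; rewrite ?expr0n.
  apply: le_trans (sqr_sum_le F) _.
  by rewrite card_prod card_ord natrM -expr2.
rewrite meanZ.
have -> : 2 * x ^+ 2 * offdiag_mean_sqr = x ^+ 2 * (2 * offdiag_mean_sqr) by ring.
apply: ler_wpM2l; first exact: sqr_ge0.
have -> : mean (fun s : 'S_N => \sum_i \sum_(j | j != i) d i j (s j) (s i) ^+ 2) =
    (N * N.-1)%:R^-1 * \sum_i \sum_j \sum_k \sum_l offdiag_sqr d i j k l.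
  rewrite mean_sum mulr_sumr; apply: eq_bigr => i _.
  have diag0 : \sum_k \sum_l offdiag_sqr d i i k l = 0.
    by apply: big1 => k _; apply: big1 => l _; rewrite /offdiag_sqr eqxx.
  rewrite mean_sum [in RHS](bigD1 i)//= diag0 add0r.
  rewrite mulr_sumr; apply: eq_bigr => j ji.
  rewrite (mean2 (fun l k => d i j k l ^+ 2)); last by rewrite eq_sym.
  congr (_ * _); rewrite [RHS]exchange_big; apply: eq_bigr => l _.
  rewrite big_mkcond; apply: eq_bigr => k _.
  by rewrite /offdiag_sqr [i == j]eq_sym ji.
rewrite /offdiag_mean_sqr mulrA; set S := \sum_i _.
have S0 : 0 <= S.
  by do 4 (apply: sumr_ge0 => ? _); apply: offdiag_sqr_ge0.
apply: ler_wpM2r => //; rewrite natrM -subn1 natrB -/x; last by rewrite (leq_trans _ N20).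
have hx := x20.
rewrite -[X in X <= _]mul1r ler_pdivrMr ?mulr_gt0//; try lra.
rewrite mulrAC ler_pdivlMr ?exprn_gt0//; try lra.
by nra.
Qed.

(** The coefficient [1 / K] is of order [N^-2] and the statistic is at most [N^2 B], so the exponent
    is small and its second moment suffices. *)
Let mgf_swapped_part :
  mean (fun s => expR (- (6 * lam / K) * (swapped_stat d s - mean (swapped_stat d)))) <=
  expR (10 ^+ 5 * offdiag_mean_sqr * lam ^+ 2).
Proof.
have hK := K1; have hx := x20.
have xK : x ^+ 2 / K <= 6 / 5.
  by rewrite ler_pdivrMr; [rewrite /K; nra | lra].
have c0 : 0 <= 6 * lam / K by rewrite divr_ge0 ?mulr_ge0//; lra.
apply: le_trans (mgf_centered_small T0 swapped_bound _) _.
  rewrite normrN ger0_norm//.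
  have -> : 2 * (6 * lam / K) * (x ^+ 2 * B) = 12 * (lam * B) * (x ^+ 2 / K) by field.
  apply: (@le_trans _ _ (12 * (lam * B) * (6 / 5))).
    by rewrite ler_wpM2l// mulr_ge0.
  by have := lamB1; lra.
rewrite ler_expR sqrrN.
have h := offdiag_mean_sqr_ge0.
apply: (@le_trans _ _ ((6 * lam / K) ^+ 2 * (2 * x ^+ 2 * offdiag_mean_sqr))).
  by rewrite ler_wpM2l ?sqr_ge0.
have -> : (6 * lam / K) ^+ 2 * (2 * x ^+ 2 * offdiag_mean_sqr) =
   (72 * (lam ^+ 2 * offdiag_mean_sqr)) * (x ^+ 2 / K) * K^-1 by field.
have h2 : 0 <= lam ^+ 2 * offdiag_mean_sqr by rewrite mulr_ge0 ?sqr_ge0.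
apply: (@le_trans _ _ ((72 * (lam ^+ 2 * offdiag_mean_sqr)) * (6 / 5) * 1)); last by lra.
apply: ler_pM.
- by apply: mulr_ge0; [exact: mulr_ge0|rewrite divr_ge0 ?sqr_ge0//; lra].
- by rewrite invr_ge0; lra.
- by rewrite ler_wpM2l// mulr_ge0.
- by rewrite invf_le1//; lra.
Qed.

(** Convexity splits the exponent into the three parts, each of which meets the same bound. No
    denominator appears, and [5400 B lam = 1] is allowed; the tail bound relies on both. *)
Theorem perm_mgf :
  mean (fun s => expR (lam * (quad_stat d s - mean (quad_stat d)))) <=
  expR (10 ^+ 5 * tensor_V d * lam ^+ 2).
Proof.
have V1 : 10 ^+ 5 * offdiag_mean_sqr * lam ^+ 2 <= 10 ^+ 5 * tensor_V d * lam ^+ 2.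
  rewrite ler_wpM2r ?sqr_ge0// ler_wpM2l ?exprn_ge0//.
  by rewrite tensor_VE lerDr centered_diag_sqr_ge0.
have V2 : 10 ^+ 5 * centered_diag_sqr * lam ^+ 2 <= 10 ^+ 5 * tensor_V d * lam ^+ 2.
  rewrite ler_wpM2r ?sqr_ge0// ler_wpM2l ?exprn_ge0//.
  by rewrite tensor_VE lerDl offdiag_mean_sqr_ge0.
rewrite -ler_expR in V1; rewrite -ler_expR in V2.
have e1 := le_trans mgf_bilinear_part V1.
have e2 := le_trans mgf_linear_part V2.
have e3 := le_trans mgf_swapped_part V1.
apply: (@le_trans _ _ (mean (fun s : 'S_N =>
   2 / 3 * expR (3 / 2 * lam * c1 * mean (Y^~ s)) +
   6^-1 * expR (6 * lam * c2 * \sum_i tensor_xi d i (s i)) +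
   6^-1 * expR (- (6 * lam / K) * (swapped_stat d s - mean (swapped_stat d)))))).
  apply: ler_mean => s; apply: le_trans (expR_convex3 _ _ _).
  rewrite ler_expR quad_stat_centered le_eqVlt; apply/orP; left; apply/eqP.
  by field.
rewrite (meanD (fun s => _ * _ + _ * _)) (meanD (fun s => 2 / 3 * _)) !meanZ.
by lra.
Qed.

End Lambda.

End Perm.
End Assembly.

(** * Operator norms *)

Section OpNorm.
Context {R : realType}.

Lemma l2norm_ge0 n (x : 'cV[R]_n) : 0 <= l2norm x.
Proof. exact: sqrtr_ge0. Qed.

Lemma sqr_l2norm n (x : 'cV[R]_n) : l2norm x ^+ 2 = \sum_(i < n) x i ord0 ^+ 2.
Proof. by rewrite sqr_sqrtr// sumr_ge0// => i _; rewrite sqr_ge0. Qed.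

Lemma l2norm_mul_le_frobenius m n (A : 'M[R]_(m, n)) (x : 'cV[R]_n) :
  l2norm (A *m x) ^+ 2 <= (\sum_i \sum_j A i j ^+ 2) * l2norm x ^+ 2.
Proof.
rewrite !sqr_l2norm mulr_suml; apply: ler_sum => i _.
by rewrite mxE; apply: cauchy_schwarz_sum.
Qed.

(** The Frobenius norm bounds the set whose supremum is taken, so [sup] is a true least upper
    bound. *)
Lemma op_norm_ubound m n (A : 'M[R]_(m, n)) (x : 'cV[R]_n) :
  l2norm x <= 1 -> l2norm (A *m x) <= op_norm A.
Proof.
move=> x1; apply: ub_le_sup; last by exists x.
set F := \sum_i \sum_j A i j ^+ 2.
have F0 : 0 <= F by apply: sumr_ge0 => i _; apply: sumr_ge0 => j _; rewrite sqr_ge0.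
(* [1 + F] dominates the square root of [F] and avoids writing it. *)
exists (1 + F) => _ [y /= y1 <-].
have F1 : 0 <= 1 + F by rewrite addr_ge0.
rewrite -ler_sqr ?nnegrE ?l2norm_ge0//.
apply: le_trans (l2norm_mul_le_frobenius A y) _; rewrite -/F.
have : l2norm y ^+ 2 <= 1 by rewrite exprn_ile1 ?l2norm_ge0.
by have := sqr_ge0 F; nra.
Qed.

Lemma op_norm_ge0 m n (A : 'M[R]_(m, n)) : 0 <= op_norm A.
Proof.
have h : l2norm (0 : 'cV[R]_n) <= 1.
  rewrite /l2norm big1 ?sqrtr0// => i _; by rewrite mxE expr0n.
exact: le_trans (l2norm_ge0 _) (op_norm_ubound A h).
Qed.

Lemma l2norm_mul_le m n (A : 'M[R]_(m, n)) (x : 'cV[R]_n) :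
  l2norm (A *m x) <= op_norm A * l2norm x.
Proof.
have [x0|xn] := eqVneq (l2norm x) 0.
  have := l2norm_mul_le_frobenius A x; rewrite x0 expr0n mulr0 mulr0 => h.
  have : l2norm (A *m x) ^+ 2 == 0 by rewrite eq_le h sqr_ge0.
  by rewrite sqrf_eq0 => /eqP->.
have xp : 0 < l2norm x by rewrite lt_def xn l2norm_ge0.
have lZ k (c : R) (y : 'cV[R]_k) : 0 <= c -> l2norm (c *: y) = c * l2norm y.
  move=> c0; apply/eqP; rewrite -(@eqrXn2 _ 2)// ?mulr_ge0 ?l2norm_ge0//.
  rewrite exprMn !sqr_l2norm mulr_sumr; apply/eqP/eq_bigr => i _.
  by rewrite mxE exprMn.
have := @op_norm_ubound _ _ A ((l2norm x)^-1 *: x).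
rewrite lZ ?invr_ge0 ?l2norm_ge0// mulVf// => /(_ (lexx _)).
by rewrite -scalemxAr lZ ?invr_ge0 ?l2norm_ge0// mulrC ler_pdivrMr.
Qed.

Lemma op_norm_bilinear m n (A : 'M[R]_(m, n)) (u : 'I_m -> R) (v : 'I_n -> R) :
  (\sum_i \sum_j u i * v j * A i j) ^+ 2 <=
  op_norm A ^+ 2 * ((\sum_i u i ^+ 2) * (\sum_j v j ^+ 2)).
Proof.
pose x : 'cV[R]_n := \col_j v j.
have xE : l2norm x ^+ 2 = \sum_j v j ^+ 2.
  by rewrite sqr_l2norm; apply: eq_bigr => j _; rewrite mxE.
have -> : \sum_i \sum_j u i * v j * A i j = \sum_i u i * (A *m x) i ord0.
  apply: eq_bigr => i _; rewrite mxE mulr_sumr; apply: eq_bigr => j _.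
  by rewrite mxE; ring.
apply: le_trans (cauchy_schwarz_sum _ _) _; rewrite mulrCA.
apply: ler_wpM2l; first by apply: sumr_ge0 => i _; rewrite sqr_ge0.
rewrite -sqr_l2norm -xE -exprMn ler_sqr ?nnegrE ?mulr_ge0 ?op_norm_ge0 ?l2norm_ge0//.
exact: l2norm_mul_le.
Qed.

Lemma tensor_B_ge0 N (d : tensor4 R N) : 0 <= tensor_B d.
Proof.
apply: le_trans (le_bigmax 0 (fun s => op_norm (tensor_mx d s)) 1%g).
exact: op_norm_ge0.
Qed.

Lemma tensor_B_bilinear N (d : tensor4 R N) (s : 'S_N) (u v : 'I_N -> R) :
  (\sum_i \sum_j u i * v j * d i j (s i) (s j)) ^+ 2 <=
  tensor_B d ^+ 2 * ((\sum_i u i ^+ 2) * (\sum_j v j ^+ 2)).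
Proof.
have := op_norm_bilinear (tensor_mx d s) u v.
under eq_bigr do under eq_bigr do rewrite mxE.
move/le_trans; apply; apply: ler_wpM2r.
  by apply: mulr_ge0; apply: sumr_ge0 => i _; rewrite sqr_ge0.
rewrite ler_sqr ?nnegrE ?op_norm_ge0 ?tensor_B_ge0//.
exact: (le_bigmax 0 (fun s => op_norm (tensor_mx d s))).
Qed.

End OpNorm.

(** * Tail bound and the probability space *)

Section FiniteTail.
Context {R : realType} {N : nat}.
Variable d : tensor4 R N.
Hypothesis N20 : (20 <= N)%N.
Hypothesis dd : degenerate d.

Let dev (s : 'S_N) := quad_stat d s - mean (quad_stat d).
Let B := tensor_B d.
Let V := tensor_V d.

Lemma tensor_V_ge0 : 0 <= V.
Proof. by rewrite /V tensor_VE addr_ge0 ?centered_diag_sqr_ge0 ?offdiag_mean_sqr_ge0. Qed.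

Lemma mgf_quad_stat lam : 0 <= lam -> 54 * 10 ^+ 2 * B * lam < 1 ->
  mean (fun s => expR (lam * dev s)) <=
  expR (10 ^+ 5 * V * lam ^+ 2 / (1 - 54 * 10 ^+ 2 * B * lam)).
Proof.
move=> lam0 lamB.
apply: le_trans (perm_mgf N20 dd (tensor_B_ge0 d) (tensor_B_bilinear d) lam0 (ltW lamB)) _.
have cB : 0 <= 54 * 10 ^+ 2 * B * lam.
  by rewrite mulr_ge0// mulr_ge0 ?tensor_B_ge0// mulr_ge0// exprn_ge0.
rewrite ler_expR ler_pdivlMr ?subr_gt0// -[leRHS]mulr1 ler_wpM2l//; last by lra.
by rewrite mulr_ge0 ?sqr_ge0// mulr_ge0 ?tensor_V_ge0// exprn_ge0.
Qed.

(** If [B = 0], then [entry_bound] makes every entry that occurs in the statistic vanish. *)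
Lemma dev_eq0 s : B = 0 -> dev s = 0.
Proof.
move=> B0; have q0 t : quad_stat d t = 0.
  apply: big1 => i _; apply: big1 => j _; apply/eqP; rewrite -normr_le0 -B0.
  exact: entry_bound (tensor_B_ge0 d) (tensor_B_bilinear d) t i j.
by rewrite /dev (eq_mean q0) mean_cst ?card_perm_gt0// q0 subrr.
Qed.

(** Chernoff's bound with [lam = t / (2 v + c t)], for which [c lam] reaches 1 when [V = 0]; hence
    the use of [perm_mgf]. *)
Lemma tail_quad_stat (t : R) : 0 < t -> 0 < B ->
  mean (fun s : 'S_N => (t <= dev s)%R%:R) <=
  expR (- (t ^+ 2 / (4 * 10 ^+ 5 * V + 108 * 10 ^+ 2 * B * t))).
Proof.
move=> t0 Bp; pose v := 10 ^+ 5 * V; pose c := 54 * 10 ^+ 2 * B; pose D := 2 * v + c * t.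
have v0 : 0 <= v by rewrite mulr_ge0 ?tensor_V_ge0// exprn_ge0.
have c0 : 0 < c by rewrite /c; lra.
have Dp : 0 < D by apply: ltr_wpDl; [exact: mulr_ge0|exact: mulr_gt0].
have -> : 4 * 10 ^+ 5 * V + 108 * 10 ^+ 2 * B * t = 2 * D by rewrite /D /v /c; ring.
pose lam := t / D.
have lam0 : 0 <= lam by rewrite divr_ge0 ?ltW.
have clam : c * lam <= 1.
  rewrite /lam mulrA ler_pdivrMr// mul1r /D; lra.
apply: (@le_trans _ _ (mean (fun s => expR (- (lam * t)) * expR (lam * dev s)))).
  apply: ler_mean => s; rewrite -expRD; case: (leP t (dev s)) => h; last exact: expR_ge0.
  rewrite -[1%:R]expR0 ler_expR addrC -mulrBr mulr_ge0// subr_ge0//.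
rewrite meanZ.
apply: (@le_trans _ _ (expR (- (lam * t)) * expR (v * lam ^+ 2))).
  rewrite ler_wpM2l ?expR_ge0//.
  have h := perm_mgf N20 dd (tensor_B_ge0 d) (tensor_B_bilinear d) lam0 clam.
  exact: h.
rewrite -expRD ler_expR.
(* Since [v / D <= 1/2], the last factor is at least 1 and the exponent is at most
   [- t^2 / (2 D)]. *)
have -> : - (lam * t) + v * lam ^+ 2 = - (t ^+ 2 / (2 * D)) * (2 - 2 * (v / D)).
  by rewrite /lam; field; rewrite gt_eqF.
have vD : v / D <= 2^-1.
  by rewrite ler_pdivrMr// /D; have : 0 <= c * t := mulr_ge0 (ltW c0) (ltW t0); lra.
rewrite mulNr lerN2 -[X in X <= _]mulr1 ler_wpM2l//; last by lra.
by rewrite divr_ge0 ?sqr_ge0// mulr_ge0// ltW.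
Qed.

End FiniteTail.

Local Open Scope classical_set_scope.
Local Open Scope ring_scope.

(** * Transfer from finite means to the probability space *)

Section UniformVariable.
Context {R : realType} {dsp : measure_display} {Omega : measurableType dsp}.
Variables (P : probability Omega R) (T : finType) (X : Omega -> T).
Hypothesis X_unif : uniformly_distributed P X.

(** The integrand is a finite combination of indicators of the fibres of [X]. *)
Lemma uniform_integral_ge0 (g : T -> R) : (forall a, 0 <= g a) ->
  (\int[P]_w (g (X w))%:E = (mean g)%:E)%E.
Proof.
move=> g0.
have mX a : measurable (X @^-1` [set a]) := (X_unif a).1.
transitivity (\int[P]_w (\sum_(a <- enum T) (g a * \1_(X @^-1` [set a]) w)%:E))%E.
  apply: eq_integral => w _; rewrite sumEFin big_enum /= (bigD1 (X w))//=.
  rewrite indicE mem_set//= mulr1 big1 ?addr0// => a aX.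
  rewrite indicE memNset ?mulr0//= => Xa; by rewrite Xa eqxx in aX.
rewrite ge0_integral_sum//; last 2 first.
- by move=> a; apply/measurable_EFinP; apply: measurable_funM => //; apply: measurable_indic.
- by move=> a w _; rewrite lee_fin mulr_ge0.
rewrite big_enum /= /mean mulr_sumr -sumEFin; apply: eq_bigr => a _.
under eq_integral do rewrite EFinM.
rewrite ge0_integralZl_EFin//; last first.
  by apply/measurable_EFinP; apply: measurable_indic.
rewrite integral_indic// classical_sets.setIT (mulrC _ (g a)) EFinM.
by congr (_ * _)%E; exact: (X_unif a).2.
Qed.

Lemma uniform_expectation (g : T -> R) :
  ('E_P[fun w => g (X w)] = (mean g)%:E)%E.
Proof.
rewrite expectation.unlock integralE.
have -> : (\int[P]_w ((fun w => (g (X w))%:E)^\+ w) =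
    \int[P]_w (Num.max (g (X w)) 0)%:E)%E.
  by apply: eq_integral => w _; rewrite funeposE EFin_max.
have -> : (\int[P]_w ((fun w => (g (X w))%:E)^\- w) =
    \int[P]_w (Num.max (- g (X w)) 0)%:E)%E.
  by apply: eq_integral => w _; rewrite funenegE EFin_max.
rewrite (uniform_integral_ge0 (g := fun a => Num.max (g a) 0)); last first.
  by move=> a; rewrite le_max lexx orbT.
rewrite (uniform_integral_ge0 (g := fun a => Num.max (- g a) 0)); last first.
  by move=> a; rewrite le_max lexx orbT.
rewrite -EFinB -meanN -meanD; congr (_%:E); apply: eq_mean => a.
by case: (lerP (g a) 0); case: (lerP (- g a) 0); lra.
Qed.

Lemma uniform_prob (p : pred T) :
  (P [set w | p (X w)] = (mean (fun a => (p a)%:R))%:E)%E.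
Proof.
have mp : measurable [set w | p (X w)].
  have -> : [set w | p (X w)] = \bigcup_(a in [set a | p a]) (X @^-1` [set a]).
    apply/seteqP; split=> [w /= pw|w [a /= pa ->]]; last by [].
    by exists (X w).
  apply: fin_bigcup_measurable; first exact: finite_finset.
  by move=> a _; exact: (X_unif a).1.
rewrite -uniform_integral_ge0; last by move=> a; rewrite ler0n.
rewrite -[LHS]/(P _) -[X in P X]setIT -integral_indic//.
by apply: eq_integral => w _; rewrite indicE mem_setE.
Qed.

End UniformVariable.

(* In the tail bound the exponent is computed in the extended reals, where
   1 / 0 = +oo and exp (-oo) = 0, so the bound stays informative when B = V = 0.
   Powers of ten avoid large unary literals. *)
Theorem theorem2p3 (R : realType) (N : nat) (d : tensor4 R N)
    (dsp : measure_display) (Omega : measurableType dsp)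
    (P : probability Omega R) (pi : Omega -> 'S_N) :
  (20 <= N)%N ->
  degenerate d ->
  uniformly_distributed P pi ->
  let Q := fun w : Omega => quad_stat d (pi w) in
  let B := tensor_B d in
  let V := tensor_V d in
  (forall lambda : R, 0 <= lambda -> 54 * 10 ^+ 2 * B * lambda < 1 ->
     ('E_P[fun w => expR (lambda * centered P Q w)]
        <= (expR (10 ^+ 5 * V * lambda ^+ 2 / (1 - 54 * 10 ^+ 2 * B * lambda)))%:E)%E) /\
  (forall t : R, 0 < t ->
     (P [set w | (t <= centered P Q w)%R]
        <= expeR (- ((t ^+ 2)%:E / (4 * 10 ^+ 5 * V + 108 * 10 ^+ 2 * B * t)%:E)))%E).
Proof.
move=> N20 dd pi_unif Q B V.
pose dev (s : 'S_N) := quad_stat d s - mean (quad_stat d).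
have QE w : centered P Q w = dev (pi w).
  by rewrite /centered (uniform_expectation pi_unif (quad_stat d)).
split=> [lam lam0 lamB|t t0].
  under [X in 'E_P[X]%E]eq_fun do rewrite QE.
  rewrite (uniform_expectation pi_unif (fun s => expR (lam * dev s))) lee_fin.
  exact: mgf_quad_stat.
have -> : [set w | (t <= centered P Q w)%R] = [set w | (t <= dev (pi w))%R].
  by apply/seteqP; split=> w /=; rewrite QE.
have probE := uniform_prob pi_unif (fun s => t <= dev s).
(* If [B = 0] the deviation vanishes, so the event is empty for [t > 0] and its probability is below
   any value of [expeR]. *)
have [B0|Bn] := eqVneq B 0.
  apply: le_trans (expeR_ge0 _); rewrite probE lee_fin /mean big1 ?mulr0// => s _.
  by rewrite /dev dev_eq0// leNgt t0.
have Bp : 0 < B by rewrite lt_def Bn tensor_B_ge0.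
apply: (@le_trans _ _ (expR (- (t ^+ 2 / (4 * 10 ^+ 5 * V + 108 * 10 ^+ 2 * B * t))))%:E).
  by rewrite probE lee_fin; exact: tail_quad_stat.
(* As [B t > 0], the denominator is nonzero and the extended quotient is the real one. *)
have D0 : 4 * 10 ^+ 5 * V + 108 * 10 ^+ 2 * B * t != 0.
  have := tensor_V_ge0 d; rewrite -/V => V0; have := mulr_gt0 Bp t0 => Bt.
  by rewrite gt_eqF//; lra.
by rewrite inver (negbTE D0).
Qed.
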